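(* Let $L>2$ be an integer, let $\gamma,\mu_1,\dots,\mu_L\in\mathbb{C}$ be fixed, and let $\lambda_0,\dots,\lambda_{L-1}$ be generic complex variables. Let $\Lambda\colon\mathbb{C}\to\mathbb{C}$ be any eigenvalue of the transfer matrix $T$ of the anti-periodic six-vertex model, and let $Z$ be the partition function of the six-vertex model with domain-wall boundaries. Let $\kappa_0=\mathcal{F}_0/\bar{\mathcal{F}}_0$ be the $\lambda_j$-independent ratio attached to $\Lambda$. (All of these, as well as the coefficient functions $M_i^{(n)}$, $N_{j,i}^{(n)}$ and the vector notation $\mathcal{O}(\cdot)$, are defined in the context.) Then the partition function can be written as $$Z(\lambda_0,\lambda_1,\dots,\lambda_{L-1})=\kappa_0\,\det(\mathcal{H}_L),$$ where $\mathcal{H}_L$ is the tridiagonal block matrix $$\mathcal{H}_L=\begin{pmatrix} \mathcal{A}_0^{(L)} & \mathcal{A}_+^{(L)} & & & & & \\ \mathcal{A}_-^{(L-1)} & \mathcal{A}_0^{(L-1)} & \mathcal{A}_+^{(L-1)} & & & & \\ & \ddots & \ddots & \ddots & & & \\ & & \mathcal{A}_-^{(m)} & \mathcal{A}_0^{(m)} & \mathcal{A}_+^{(m)} & & \\ & & & \ddots & \ddots & \ddots & \\ & & & & \mathcal{A}_-^{(3)} & \mathcal{A}_0^{(3)} & \mathcal{A}_+^{(3)}\\ & & & & & \mathcal{A}_-^{(2)} & \mathcal{A}_0^{(2)} \end{pmatrix}$$ with the following blocks. 1. For $m=3,4,\dots,L$: $\mathcal{A}_+^{(m)}=-\mathbb{1}_{[m]}$,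 where $\mathbb{1}_d$ is the $d\times d$ identity matrix and $$[m]=\begin{cases}\dfrac{(L-1)!}{(m-2)!\,(L-m+1)!} & m \text{ even},\\[2mm] \dfrac{L!}{(m-1)!\,(L-m+1)!} & m\text{ odd}.\end{cases}$$ 2. For $m>2$: $\mathcal{A}_0^{(m)}$ is the $[m]\times[m+1]$ matrix $$\mathcal{A}_0^{(m)}=\begin{pmatrix}\mathcal{W}_m^{(m)}&0&\dots&0\\ \mathcal{W}_{m-1}^{(m)}&0&\dots&0\\ \vdots&0&\dots&0\\ \mathcal{W}_3^{(m)}&0&\dots&0\\ \mathcal{W}_2^{(m)}&0&\dots&0\end{pmatrix}\ (m\text{ even}),\qquad \mathcal{A}_0^{(m)}=\begin{pmatrix}\mathcal{W}_m^{(m)}&0&\dots&0\\ \mathcal{W}_{m-1}^{(m)}&0&\dots&0\\ \vdots&0&\dots&0\\ \mathcal{W}_2^{(m)}&0&\dots&0\\ \mathcal{W}_1^{(m)}&0&\dots&0\end{pmatrix}\ (m\text{ odd}),$$ where in both cases $\mathcal{W}_k^{(m)}=\Lambda(\lambda_{k-1})\,\mathbb{1}_{\{m;k\}}$ with $\{m;k\}=\dfrac{(L-k)!}{(m-k)!\,(L-m)!}$ (each block is padded on the right by zeros). 3. For $m>2$ even: $\mathcal{A}_-^{(m)}$ has dimension $[m]\times[m+2]$ and entries $$\left(\mathcal{A}_-^{(m)}\right)_{r_{i_1,\dots,i_{m-2}},\,s_{j_1,\dots,j_m}}=-\prod_{t=1}^{m-2}\delta_{i_t,j_t}\times\begin{cases}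 M_k^{(L-m)}\!\left(\mathcal{O}(X^{1,L-1}_{i_1,\dots,i_{m-2}})\right) & \text{if } \mathcal{O}(X^{1,L-1}_{i_1,\dots,i_{m-2}})_{1,k+1}=\mathcal{O}(X^{1,L-1}_{j_1,\dots,j_m}),\\[1mm] N_{l,k}^{(L-m)}\!\left(\mathcal{O}(X^{1,L-1}_{i_1,\dots,i_{m-2}})\right) & \text{if } \mathcal{O}(X^{1,L-1}_{i_1,\dots,i_{m-2}})_{k+1,l+1}=\mathcal{O}(X^{1,L-1}_{j_1,\dots,j_m}), \end{cases}$$ where $r_{i_1,\dots,i_{m-2}}$ is the integer assigned to the ordering $1\le i_1<\dots<i_{m-2}\le L-1$ and $s_{j_1,\dots,j_m}$ is the integer assigned to the ordering $1\le j_1<\dots<j_m\le L-1$. 4. For $m>2$ odd: $\mathcal{A}_-^{(m)}$ has dimension $[m]\times[m+2]$ and entries $$\left(\mathcal{A}_-^{(m)}\right)_{\bar r_{i_1,\dots,i_{m-1}},\,\bar s_{j_1,\dots,j_{m+1}}}=-\prod_{t=1}^{m-1}\delta_{i_t,j_t}\times\begin{cases} M_k^{(L-m)}\!\left(\mathcal{O}(X^{0,L-1}_{i_1,\dots,i_{m-1}})\right) & \text{if } \mathcal{O}(X^{0,L-1}_{i_1,\dots,i_{m-1}})_{1,k+1}=\mathcal{O}(X^{0,L-1}_{j_1,\dots,j_{m+1}}),\\[1mm] N_{l,k}^{(L-m)}\!\left(\mathcal{O}(X^{0,L-1}_{i_1,\dots,i_{m-1}})\right) & \text{if } \mathcal{O}(X^{0,L-1}_{i_1,\dots,i_{m-1}})_{k+1,l+1}=\mathcal{O}(X^{0,L-1}_{j_1,\dots,j_{m+1}}),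 \end{cases}$$ where $\bar r_{i_1,\dots,i_{m-1}}$ is the integer assigned to the ordering $0\le i_1<\dots<i_{m-1}\le L-1$ and $\bar s_{j_1,\dots,j_{m+1}}$ is the integer assigned to the ordering $0\le j_1<\dots<j_{m+1}\le L-1$. 5. Finally, $$\mathcal{A}_-^{(2)}=-\Lambda(\lambda_0)\big(M_1^{(L-2)},M_2^{(L-2)},\dots,M_{L-2}^{(L-2)},N_{2,1}^{(L-2)},N_{3,1}^{(L-2)},\dots,N_{L-2,1}^{(L-2)},N_{3,2}^{(L-2)},\dots,N_{L-2,2}^{(L-2)},\dots,N_{L-2,L-3}^{(L-2)}\big),$$ $$\mathcal{A}_0^{(2)}=-\big(M_1^{(L-1)}-\Lambda(\lambda_0)\Lambda(\lambda_1),M_2^{(L-1)},\dots,M_{L-1}^{(L-1)},N_{2,1}^{(L-1)},N_{3,1}^{(L-1)},\dots,N_{L-1,1}^{(L-1)},N_{3,2}^{(L-1)},\dots,N_{L-1,2}^{(L-1)},\dots,N_{L-1,L-2}^{(L-1)}\big),$$ where $M_i^{(L-2)},N_{j,i}^{(L-2)}$ are evaluated at $(\lambda_1,\lambda_2,\dots,\lambda_{L-1})$ and $M_i^{(L-1)},N_{j,i}^{(L-1)}$ at $(\lambda_0,\lambda_1,\dots,\lambda_{L-1})$.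
   Context: **Weights.** $a(\lambda)=\sinh(\lambda+\gamma)$, $b(\lambda)=\sinh(\lambda)$, $c(\lambda)=\sinh(\gamma)$ (constant, also written $c$). **Transfer matrix and partition function.** Let $e_1,e_2$ be the standard basis of $\mathbb{C}^2$ and define $R(\lambda)\in\mathrm{End}(\mathbb{C}^2\otimes\mathbb{C}^2)$ in the ordered basis $e_1\otimes e_1,\,e_1\otimes e_2,\,e_2\otimes e_1,\,e_2\otimes e_2$ by $$R(\lambda)=\begin{pmatrix}a(\lambda)&0&0&0\\0&b(\lambda)&c&0\\0&c&b(\lambda)&0\\0&0&0&a(\lambda)\end{pmatrix}.$$ On $\mathbb{C}^2_{\mathtt a}\otimes(\mathbb{C}^2)^{\otimes L}$, with $\mathtt a$ the auxiliary factor, the monodromy matrix is $R_{\mathtt a1}(\lambda-\mu_1)\cdots R_{\mathtt aL}(\lambda-\mu_L)$, written $\begin{pmatrix}A(\lambda)&B(\lambda)\\C(\lambda)&D(\lambda)\end{pmatrix}$ in the auxiliary space. The anti-periodic transfer matrix is $T(\lambda)=B(\lambda)+C(\lambda)\in\mathrm{End}((\mathbb{C}^2)^{\otimes L})$; it satisfies $[T(\lambda),T(\lambda')]=0$ for all $\lambda,\lambda'$. Put $|0\rangle=e_1^{\otimes L}$ and $|\bar0\rangle=e_2^{\otimes L}$ (the $\mathfrak{sl}_2$ highest and lowest weight vectors). The partition function $Z\colon\mathbb{C}^L\to\mathbb{C}$ of the six-vertex model with domain-wall boundaries on the $L\times L$ lattice is given by $B(\lambda_1)\cdots B(\lambda_L)|0\rangle=Z(\lambda_1,\dots,\lambda_L)|\bar0\rangle$;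 it is symmetric in its arguments. **The ratio $\kappa_0$.** The eigenvalue problem is $T(\lambda)|\Psi\rangle=\Lambda(\lambda)|\Psi\rangle$. The numbers $\mathcal{F}_0=\langle\Psi|0\rangle$ and $\bar{\mathcal{F}}_0=\langle\Psi|\bar0\rangle$ are the projections of the eigenvector associated to $\Lambda$ on the highest and lowest weight vectors, and $\kappa_0=\mathcal{F}_0/\bar{\mathcal{F}}_0$. **Variable sets and vectors.** $X^{p,q}=\{\lambda_k\mid p\le k\le q\}$ and $X^{p,q}_{i_1,\dots,i_m}=X^{p,q}\setminus\{\lambda_{i_1},\dots,\lambda_{i_m}\}$. For such a set, $\mathcal{O}(\cdot)$ is the vector of its elements in increasing order of the index of the variables $\lambda_i$; in particular $\mathcal{O}(X^{p,q})=(\lambda_p,\lambda_{p+1},\dots,\lambda_q)$. For a vector $\mathcal{O}$, $\mathcal{O}_i$ is the vector obtained by removing its $i$-th component, and $\mathcal{O}_{i,j}=(\mathcal{O}_i)_j$ is the vector obtained by removing the $j$-th component of $\mathcal{O}_i$. $\delta_{i,j}$ is the Kronecker delta. **Coefficient functions.** For $n\in\{1,\dots,L+1\}$ and $1\le i\le n$, $$M_i^{(n)}(\lambda_0,\dots,\lambda_n)=\frac{c(\lambda_i-\lambda_0)}{b(\lambda_i-\lambda_0)}\prod_{\substack{k=1\\k\ne i}}^n\frac{a(\lambda_i-\lambda_k)}{b(\lambda_i-\lambda_k)}\frac{a(\lambda_k-\lambda_0)}{b(\lambda_k-\lambda_0)}\prod_{l=1}^La(\lambda_0-\mu_l)b(\lambda_i-\mu_l)$$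 $$\qquad+\frac{c(\lambda_0-\lambda_i)}{b(\lambda_0-\lambda_i)}\prod_{\substack{k=1\\k\ne i}}^n\frac{a(\lambda_0-\lambda_k)}{b(\lambda_0-\lambda_k)}\frac{a(\lambda_k-\lambda_i)}{b(\lambda_k-\lambda_i)}\prod_{l=1}^La(\lambda_i-\mu_l)b(\lambda_0-\mu_l),$$ and for $1\le i<j\le n$, $$N_{j,i}^{(n)}(\lambda_0,\dots,\lambda_n)=\frac{c(\lambda_j-\lambda_0)}{a(\lambda_j-\lambda_0)}\frac{c(\lambda_0-\lambda_i)}{a(\lambda_0-\lambda_i)}\frac{a(\lambda_j-\lambda_i)}{b(\lambda_j-\lambda_i)}\prod_{\substack{k=0\\k\ne i,j}}^n\frac{a(\lambda_j-\lambda_k)}{b(\lambda_j-\lambda_k)}\frac{a(\lambda_k-\lambda_i)}{b(\lambda_k-\lambda_i)}\prod_{l=1}^La(\lambda_i-\mu_l)b(\lambda_j-\mu_l)$$ $$\qquad+\frac{c(\lambda_i-\lambda_0)}{a(\lambda_i-\lambda_0)}\frac{c(\lambda_0-\lambda_j)}{a(\lambda_0-\lambda_j)}\frac{a(\lambda_i-\lambda_j)}{b(\lambda_i-\lambda_j)}\prod_{\substack{k=0\\k\ne i,j}}^n\frac{a(\lambda_i-\lambda_k)}{b(\lambda_i-\lambda_k)}\frac{a(\lambda_k-\lambda_j)}{b(\lambda_k-\lambda_j)}\prod_{l=1}^La(\lambda_j-\mu_l)b(\lambda_i-\mu_l).$$ The $n+1$ arguments are positional: evaluating at a vector $(x_0,\dots,x_n)$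 means replacing $\lambda_r$ by $x_r$. The product over $l$ always runs over $\mu_1,\dots,\mu_L$. **Index conventions.** The integers $r,s,\bar r,\bar s$ number the increasing tuples in lexicographic order, and an entry of $\mathcal{A}_-^{(m)}$ to which neither listed case applies is zero.
   Formalization: In O_{i,j} both i and j number components of O itself (literally (O_1)_{k+1} fails to exist for k=n), and the product of deltas δ_{i_t,j_t} is read as ''every i_t occurs among the j's''; ⟨Ψ| is the left eigenvector of T with eigenvalue Λ, and F̄_0 is nonzero. *)

(* Defs.v *)
From HB Require Import structures.
From mathcomp Require Import all_boot all_order all_algebra.
From mathcomp.real_closed Require Import complex.
From mathcomp.reals Require Import reals.
From mathcomp.analysis Require Import sequences trigo.

Set Implicit Arguments.
Unset Strict Implicit.
Unset Printing Implicit Defensive.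

From mathcomp Require Import zify.

Import Order.TTheory GRing.Theory Num.Theory.
Local Open Scope ring_scope.
Local Open Scope complex_scope.

Section ComplexSinh.
Variable R : realType.
Implicit Type z : R[i].

Definition cexp z : R[i] :=
  (expR (complex.Re z))%:C * (cos (complex.Im z) +i* sin (complex.Im z)).

Definition csinh z : R[i] := (cexp z - cexp (- z)) / 2%:R.

End ComplexSinh.

Section SixVertex.
Variables (R : realType) (L : nat) (gamma : R[i]).
Local Notation C := R[i].

Definition wa (u : C) : C := csinh (u + gamma).
Definition wb (u : C) : C := csinh u.
Definition wc (u : C) : C := csinh gamma.

Definition Rmx (u : C) : 'M[C]_4 :=
  \matrix_(p, q)
    nth 0 (nth [::] [:: [:: wa u; 0;    0;    0   ];
                        [:: 0;    wb u; wc u; 0   ];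
                        [:: 0;    wc u; wb u; 0   ];
                        [:: 0;    0;    0;    wa u]] p) q.

(* The configuration x : {ffun 'I_L -> 'I_2} labels the basis vector
   e_(1 + x 0) (x) ... (x) e_(1 + x (L-1)) of (C^2)^{(x) L}. *)
Definition config := {ffun 'I_L -> 'I_2}.
Local Notation Q := #|{: config}|.

(* The operator E acting on the j-th factor of (C^2)^{(x) L}. *)
Definition site (j : 'I_L) (E : 'M[C]_2) : 'M[C]_Q :=
  \matrix_(p, q)
    let x : config := enum_val p in let y : config := enum_val q in
    if [forall k, (k != j) ==> (x k == y k)] then E (x j) (y j) else 0.

(* Operators on the tensor product of the auxiliary C^2 (first factor) and
   (C^2)^{(x) L} are written as 2 x 2 matrices over End((C^2)^{(x) L}); since
   e_(1+al) (x) e_(1+be) has position 2 al + be in the basis of Rmx, the entry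
   (al, al') of R_{aj} is the corresponding 2 x 2 block of Rmx at site j. *)
Definition Raux (j : 'I_L) (u : C) : 'M['M[C]_Q]_2 :=
  \matrix_(al, al')
    site j (\matrix_(be < 2, be' < 2)
              Rmx u (inord (2 * al + be)) (inord (2 * al' + be'))).

Variable mu : L.-tuple C.

Definition monodromy (u : C) : 'M['M[C]_Q]_2 :=
  \prod_(j < L) Raux j (u - tnth mu j).

Definition opB (u : C) : 'M[C]_Q := monodromy u ord0 ord_max.
Definition opC (u : C) : 'M[C]_Q := monodromy u ord_max ord0.
Definition transfer (u : C) : 'M[C]_Q := opB u + opC u.

Definition ket_config (x : config) : 'cV[C]_Q := delta_mx (enum_rank x) 0.
Definition vac : 'cV[C]_Q := ket_config [ffun=> ord0].
Definition vac_bar : 'cV[C]_Q := ket_config [ffun=> ord_max].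

(* B(x_1) ... B(x_L) |0> is a multiple of |0bar>, see partition_functionP. *)
Definition partition_function (x : L.-tuple C) : C :=
  ((\prod_(u <- x) opB u) *m vac) (enum_rank ([ffun=> ord_max] : config)) 0.

Let wt (p : 'I_Q) : nat := (\sum_(k < L) (enum_val p : config) k)%N.

Let ice_rule (P : 'M['M[C]_Q]_2) := forall al al' p q,
  P al al' p q != 0 -> (al + wt p = al' + wt q)%N.

Let sum_ne0 (I : finType) (F : I -> C) :
  \sum_i F i != 0 -> exists i, F i != 0.
Proof.
move=> F0; apply/existsP; apply: contraNT F0 => /existsPn F0.
by rewrite big1 // => i _; apply/eqP; rewrite -[_ == _]negbK.
Qed.

Let ice_Raux j u : ice_rule (Raux j u).
Proof.
move=> al al' p q; rewrite !mxE /=; case: ifP => [/forallP eqk|]; last by rewrite eqxx.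
rewrite !mxE => nz; rewrite /wt (bigD1 j) //= [in RHS](bigD1 j) //=.
rewrite !addnA; congr (_ + _)%N; last first.
  by apply: eq_bigr => k kj; have := eqk k; rewrite kj => /eqP ->.
move: nz; rewrite !inordK; last 2 first.
- by case: al' (enum_val q j) => [[|[|?]] ?] // [[|[|?]] ?].
- by case: al (enum_val p j) => [[|[|?]] ?] // [[|[|?]] ?].
case: al al' (enum_val p j) (enum_val q j) => [[|[|?]] ?] // [[|[|?]] ?] //;
  by move=> [[|[|?]] ?] // [[|[|?]] ?] //=; rewrite eqxx.
Qed.

Let ice_monodromy u : ice_rule (monodromy u).
Proof.
rewrite /monodromy; apply: big_ind => [|P1 P2 ice1 ice2|j _]; last exact: ice_Raux.
- move=> al al' p q; rewrite mxE; case: (al =P al') => [<-|_]; rewrite mxE ?eqxx //.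
  by case: (p =P q) => [->|]; rewrite ?eqxx.
- move=> al al' p q; rewrite mxE summxE => /sum_ne0[be]; rewrite mxE.
  by case/sum_ne0 => r; rewrite mulf_eq0 => /norP[/ice1 -> /ice2 ->].
Qed.

Lemma partition_functionP (x : L.-tuple C) :
  (\prod_(u <- x) opB u) *m vac = partition_function x *: vac_bar.
Proof.
have icepB (s : seq C) p q : (\prod_(u <- s) opB u) p q != 0 ->
    wt p = (size s + wt q)%N.
  elim: s p q => [|u s IH] p q.
    by rewrite big_nil mxE; case: (p =P q) => [->|]; rewrite ?eqxx.
  rewrite big_cons mxE => /sum_ne0[r]; rewrite mulf_eq0 => /norP[/ice_monodromy].
  by rewrite add0n => -> /IH -> /=; rewrite add1n addSn.
apply/matrixP => p q; rewrite (ord1 q) /partition_function [RHS]mxE [X in _ * X]mxE.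
case: (eqVneq p (enum_rank ([ffun=> ord_max] : config))) => [->|pN].
  by rewrite eqxx mulr1.
rewrite mulr0; apply/eqP; apply: contraNT pN.
rewrite mxE => /sum_ne0[r]; rewrite mxE mulf_eq0 => /norP[/icepB pr].
case: (r =P _) pr => [->|_ _]; last by rewrite /= eqxx.
rewrite size_tuple /wt enum_rankK.
rewrite [X in (_ + X)%N]big1 => [|k _]; last by rewrite ffunE.
rewrite addn0 => sumE _; apply/eqP; apply: enum_val_inj; rewrite enum_rankK.
have le1 (k : 'I_L) : (enum_val p k <= 1)%N by rewrite -ltnS ltn_ord.
have : (\sum_(k < L) (1 - (enum_val p : config) k) == 0)%N.
  by rewrite sumnB // sumE sum1_card card_ord subnn.
rewrite sum_nat_eq0 => /forallP eq1; apply/ffunP => k; apply: val_inj.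
have := eq1 k; have := le1 k; rewrite ffunE /=.
by case: (enum_val p k) => [[|[|?]] ?].
Qed.

(* Lambda(u) is the eigenvalue of T(u) on an eigenvector independent of u. *)
Definition is_eigenvector (Lambda : C -> C) (Psi : 'cV[C]_Q) : Prop :=
  Psi != 0 /\ forall u, transfer u *m Psi = Lambda u *: Psi.

(* The bra <Psi| is the dual (left) eigenvector with the same eigenvalue. *)
Definition is_dual_eigenvector (Lambda : C -> C) (bra : 'rV[C]_Q) : Prop :=
  bra != 0 /\ forall u, bra *m transfer u = Lambda u *: bra.

Definition F0 (bra : 'rV[C]_Q) : C := (bra *m vac) 0 0.
Definition F0_bar (bra : 'rV[C]_Q) : C := (bra *m vac_bar) 0 0.
Definition kappa0 (bra : 'rV[C]_Q) : C := F0 bra / F0_bar bra.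

(* M_i^{(n)} and N_{j,i}^{(n)} at the vector x = (x_0, ..., x_n). *)
Definition coefM (n i : nat) (x : seq C) : C :=
  wc (x`_i - x`_0) / wb (x`_i - x`_0)
    * \prod_(1 <= k < n.+1 | k != i)
        (wa (x`_i - x`_k) / wb (x`_i - x`_k)
         * (wa (x`_k - x`_0) / wb (x`_k - x`_0)))
    * \prod_(m <- mu) (wa (x`_0 - m) * wb (x`_i - m))
  + wc (x`_0 - x`_i) / wb (x`_0 - x`_i)
    * \prod_(1 <= k < n.+1 | k != i)
        (wa (x`_0 - x`_k) / wb (x`_0 - x`_k)
         * (wa (x`_k - x`_i) / wb (x`_k - x`_i)))
    * \prod_(m <- mu) (wa (x`_i - m) * wb (x`_0 - m)).

Definition coefN (n j i : nat) (x : seq C) : C :=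
  wc (x`_j - x`_0) / wa (x`_j - x`_0)
    * (wc (x`_0 - x`_i) / wa (x`_0 - x`_i))
    * (wa (x`_j - x`_i) / wb (x`_j - x`_i))
    * \prod_(0 <= k < n.+1 | (k != i) && (k != j))
        (wa (x`_j - x`_k) / wb (x`_j - x`_k)
         * (wa (x`_k - x`_i) / wb (x`_k - x`_i)))
    * \prod_(m <- mu) (wa (x`_i - m) * wb (x`_j - m))
  + wc (x`_i - x`_0) / wa (x`_i - x`_0)
    * (wc (x`_0 - x`_j) / wa (x`_0 - x`_j))
    * (wa (x`_i - x`_j) / wb (x`_i - x`_j))
    * \prod_(0 <= k < n.+1 | (k != i) && (k != j))
        (wa (x`_i - x`_k) / wb (x`_i - x`_k)
         * (wa (x`_k - x`_j) / wb (x`_k - x`_j)))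
    * \prod_(m <- mu) (wa (x`_j - m) * wb (x`_i - m)).

(* Genericity: no denominator of the coefficient functions vanishes. *)
Definition generic (lam : L.-tuple C) : Prop :=
  forall i j : 'I_L, i != j ->
    wa (tnth lam i - tnth lam j) != 0 /\ wb (tnth lam i - tnth lam j) != 0.

End SixVertex.

(* Increasing tuples i_1 < ... < i_k from the increasing sequence s, in
   lexicographic order. *)
Fixpoint incr_tuples (k : nat) (s : seq nat) : seq (seq nat) :=
  match k, s with
  | 0, _ => [:: [::]]
  | _.+1, [::] => [::]
  | k'.+1, i :: s' => map (cons i) (incr_tuples k' s') ++ incr_tuples k s'
  end.

Lemma mem_incr_tuples k s t :
  (t \in incr_tuples k s) = (size t == k) && subseq t s.
Proof.
have inj_cons i : injective (cons i : seq nat -> seq nat) by move=> ? ? [].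
elim: s k t => [|i s IH] [|k] t; try by case: t.
by case: t => //= j t; rewrite andbF.
rewrite [incr_tuples _ _]/= mem_cat IH; case: t => [|j t].
  by rewrite orbF; apply/mapP => -[].
rewrite [size _]/= eqSS [subseq _ (i :: s)]/=; case: (j =P i) => [->|ji].
  rewrite (mem_map (inj_cons i)) IH; case: eqP => //= _.
  by apply/orb_idr; apply: cons_subseq.
by case: mapP => // -[t' _ []].
Qed.

Lemma size_incr_tuples k s : size (incr_tuples k s) = 'C(size s, k).
Proof.
elim: s k => [|i s IH] [|k]; rewrite ?bin0 //=.
by rewrite size_cat size_map !IH binS addnC.
Qed.

Lemma sorted_incr_tuples k s : sorted ltn s ->
  sorted <%O (incr_tuples k s : seq (seqlexi nat)).
Proof.
rewrite (sorted_pairwise lt_trans) (sorted_pairwise ltn_trans).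
elim: s k => [|i s IH] [|k] //= /andP[/allP lti /IH{}IH].
rewrite pairwise_cat IH andbT pairwise_map; apply/andP; split.
  apply/allrelP => u v /mapP[u' _ ->]; rewrite mem_incr_tuples => /andP[].
  case: v => // j v _ /mem_subseq/(_ j (mem_head _ _))/lti /= ij.
  by rewrite ltxi_cons leEnat (ltnW ij) leqNgt ij.
apply: sub_pairwise (IH k) => u v uv /=.
by rewrite ltxi_cons lexx.
Qed.

(* O(X^{p,q}_{i_1,...,i_m}), with the variable lambda_k represented by k. *)
Definition Ovec (p q : nat) (ii : seq nat) : seq nat :=
  [seq k <- iota p (q.+1 - p) | k \notin ii].

(* The vector s without its i-th component, numbered from 1. *)
Definition del (i : nat) (s : seq nat) : seq nat := take i.-1 s ++ drop i s.

(* O_{i,j} for i < j: i and j both refer to the numbering of the components of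
   O itself, so that the components 1 and k+1 (resp. k+1 and l+1) of
   (x_0, ..., x_n) are x_0 and x_k (resp. x_k and x_l).  Removing the j-th
   component first leaves the i-th one in place. *)
Definition del2 (i j : nat) (s : seq nat) : seq nat := del i (del j s).

Section BlockSizes.
Local Open Scope nat_scope.
Variable L : nat.

(* [m] *)
Definition bdim (m : nat) : nat :=
  if odd m then L`! %/ ((m - 1)`! * (L.+1 - m)`!)
  else (L - 1)`! %/ ((m - 2)`! * (L.+1 - m)`!).

(* {m;k} *)
Definition wdim (m k : nat) : nat := (L - k)`! %/ ((m - k)`! * (L - m)`!).

(* The increasing tuples numbering the rows of A_-^{(m)}; those numbering its
   columns are the same with m + 2 in place of m. *)
Definition block_tuples (m : nat) : seq (seq nat) :=
  if odd m then incr_tuples (m - 1) (iota 0 L)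
  else incr_tuples (m - 2) (iota 1 (L - 1)).

Lemma bdim2 : 0 < L -> bdim 2 = 1.
Proof.
by move=> L0; rewrite /bdim [odd 2]/= subnn fact0 mul1n subSS divnn fact_gt0.
Qed.

Lemma bdimL1 : 0 < L -> bdim L.+1 = 1.
Proof.
move=> L0; rewrite /bdim subnn fact0 !muln1 !subSS subn0.
by case: ifP => _; rewrite divnn fact_gt0.
Qed.

Lemma sum_bdim :
  \sum_(j < L.-1) bdim (L.+1 - j) = \sum_(i < L.-1) bdim (L - i).
Proof.
have [L1|L1] := leqP L 1; first by case: L L1 => [|[|]] // _; rewrite !big_ord0.
have -> : L.-1 = L.-2.+1 by case: L L1 => [|[|]].
rewrite big_ord_recl [RHS]big_ord_recr /= subn0 addnC; congr (_ + _).
have -> : L - L.-2 = 2 by case: L L1 => [|[|l]] // _; rewrite /= -addn2 addKn.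
by rewrite bdimL1 ?bdim2 // ltnW.
Qed.

Lemma bdimE m : 1 < m <= L.+1 ->
  bdim m = if odd m then 'C(L, m - 1) else 'C(L - 1, m - 2).
Proof.
case/andP=> m1 mL; rewrite /bdim; case: ifP => _.
  have -> : L.+1 - m = L - (m - 1) by lia.
  by rewrite -bin_factd //; lia.
have -> : L.+1 - m = L - 1 - (m - 2) by lia.
have [L0|L0] := posnP (L - 1); last by rewrite -bin_factd.
have -> : m - 2 = 0 by lia.
by rewrite L0 bin0.
Qed.

Lemma size_block_tuples m : 1 < m <= L.+1 -> size (block_tuples m) = bdim m.
Proof.
move=> mL; rewrite (bdimE mL) /block_tuples.
by case: ifP => _; rewrite size_incr_tuples size_iota.
Qed.

Lemma wdimE m k : k <= m <= L -> wdim m k = 'C(L - k, m - k).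
Proof.
case/andP=> km mL; have [Lk|Lk] := posnP (L - k).
  have -> : m = k by lia.
  by rewrite /wdim Lk subnn bin0.
rewrite /wdim bin_factd //.
by have -> : L - k - (m - k) = L - m by lia.
Qed.

Lemma sum_wdim m : 1 < m <= L ->
  \sum_(t < if odd m then m else m.-1) wdim m (m - t) = bdim m.
Proof.
move=> /andP[m1 mL].
have hockey a n : \sum_(t < n.+1) 'C(a + t, t) = 'C(a + n.+1, n).
  elim: n => [|n IH]; first by rewrite big_ord_recl big_ord0 !bin0.
  by rewrite big_ord_recr IH /= [a + n.+2]addnS binS addnC.
have mL1 : 1 < m <= L.+1 by rewrite m1 leqW.
rewrite (bdimE mL1); set K := (X in 'I_X).
have -> : \sum_(t < K) wdim m (m - t) = \sum_(t < K) 'C(L - m + t, t).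
  apply: eq_bigr => t _; have := ltn_ord t; have : K <= m by rewrite /K; case: odd; lia.
  by move=> ? ?; rewrite wdimE; [congr 'C(_, _)|]; lia.
rewrite {}/K; case: ifP => _.
  have [n nE] : exists n, m = n.+1 by exists m.-1; lia.
  rewrite nE hockey subn1 /=.
  by have -> : L - n.+1 + n.+1 = L by lia.
have [n nE] : exists n, m = n.+2 by exists m.-2; lia.
rewrite nE hockey subSS subn1 /=.
have -> : L - n.+2 + n.+1 = L - 1 by lia.
by rewrite ?subn1.
Qed.

End BlockSizes.

Section BlockMatrix.
Variables (R : realType) (L : nat) (gamma : R[i]) (mu : L.-tuple R[i]).
Variables (Lambda : R[i] -> R[i]) (lam : L.-tuple R[i]).
Local Notation C := R[i].
Local Notation "[ m ]" := (bdim L m) (format "[ m ]").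

Definition eval_vec (s : seq nat) : seq C := [seq lam`_k | k <- s].

Definition Aplus (m : nat) : 'M[C]_[m] := - 1%:M.

(* The blocks W_k^{(m)}, padded on the right by zeros, are stacked for
   k = m, m - 1, ..., 2 (m even) or 1 (m odd); their heights add up to [m] by
   sum_wdim, so that conform_mx only transports along this equality. *)
Definition Azero_gt2 (m : nat) : 'M[C]_([m], [m.+1]) :=
  conform_mx 0
    (\mxcol_(t < if odd m then m else m.-1)
        (Lambda lam`_(m - t).-1 *:
         (pid_mx (wdim L m (m - t)) : 'M[C]_(wdim L m (m - t), [m.+1])))).

(* The entry of A_-^{(m)} in the row numbered ii and the column numbered jj,
   the variables being lambda_p, ..., lambda_(L-1).  At most one summand is
   nonzero, since the components of O are distinct.  The condition required by
   the Kronecker deltas is that each i_t is one of the indices jj. *)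
Definition Aminus_entry (p m : nat) (ii jj : seq nat) : C :=
  let n := (L - m)%N in
  let O := Ovec p (L - 1) ii in
  let O' := Ovec p (L - 1) jj in
  - ((\prod_(i <- ii) (i \in jj)%:R)
     * (\sum_(1 <= k < n.+1 | del2 1 k.+1 O == O')
          coefM gamma mu n k (eval_vec O)
        + \sum_(1 <= k < n.+1) \sum_(k.+1 <= l < n.+1
                                       | del2 k.+1 l.+1 O == O')
            coefN gamma mu n l k (eval_vec O))).

Definition Aminus_gt2 (m : nat) : 'M[C]_([m], [m.+2]) :=
  \matrix_(r, s)
    Aminus_entry (if odd m then 0%N else 1%N) m
      (nth [::] (block_tuples L m) r) (nth [::] (block_tuples L m.+2) s).

(* (M_1, ..., M_n, N_{2,1}, ..., N_{n,1}, N_{3,2}, ..., N_{n,2}, ...,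
   N_{n,n-1}) evaluated at x. *)
Definition coef_list (n : nat) (x : seq C) : seq C :=
  [seq coefM gamma mu n k x | k <- iota 1 n]
  ++ [seq coefN gamma mu n l k x | k <- iota 1 n, l <- iota k.+1 (n - k)].

Lemma size_coef_list n x : size (coef_list n x) = 'C(n.+1, 2).
Proof.
rewrite size_cat size_map size_iota size_allpairs_dep binS bin1 addnC.
congr (_ + _)%N; rewrite (_ : map _ _ = [seq (n - k)%N | k <- iota 1 n]); last first.
  by apply: eq_map => k; rewrite size_iota.
rewrite sumnE big_map (_ : iota 1 n = index_iota 1 n.+1); last first.
  by rewrite /index_iota subn1.
rewrite big_add1 -bin2_sum big_nat_rev /=.
by apply: eq_big_nat => k /andP[_ kn]; lia.
Qed.

Definition Aminus2 : 'M[C]_([2], [4]) :=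
  \matrix_(r, s)
    - (Lambda lam`_0 * (coef_list (L - 2) (eval_vec (iota 1 (L - 1))))`_s).

Definition Azero2 : 'M[C]_([2], [3]) :=
  \matrix_(r, s)
    - ((coef_list (L - 1) lam)`_s
       - (Lambda lam`_0 * Lambda lam`_1) *+ (s == 0%N :> nat)).

Definition Aminus (m : nat) : 'M[C]_([m], [m.+2]) :=
  if m == 2 then conform_mx 0 Aminus2 else Aminus_gt2 m.

Definition Azero (m : nat) : 'M[C]_([m], [m.+1]) :=
  if m == 2 then conform_mx 0 Azero2 else Azero_gt2 m.

(* The block of H_L in the block row of height [m] and in the block column of
   width [w]. *)
Definition Hblock (m w : nat) : 'M[C]_([m], [w]) :=
  if w == m.+2 then conform_mx 0 (Aminus m)
  else if w == m.+1 then conform_mx 0 (Azero m)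
  else if w == m then conform_mx 0 (Aplus m)
  else 0.

(* The block rows have heights [L], [L-1], ..., [2] and the block columns have
   widths [L+1], [L], ..., [3]; H_L is square by sum_bdim. *)
Definition HL : 'M[C]_(\sum_(i < L.-1) [L - i]) :=
  castmx (erefl, sum_bdim L)
    (\mxblock_(i < L.-1, j < L.-1) Hblock (L - i) (L.+1 - j)).

End BlockMatrix.

(* Main.v *)
(* Write [phi x] for the scalar product of the dual eigenvector with
   B(x_1) ... B(x_n)|0>.  Pairing T(x_0) = B(x_0) + C(x_0) with the dual
   eigenvector gives Lambda(x_0) phi(x_1, ..., x_n) = phi(x_0, ..., x_n) plus
   the contribution of C(x_0), which the algebraic Bethe ansatz expands into
   vectors with n - 1 operators B, with coefficients M_i^{(n)} and
   N_{j,i}^{(n)}.  These relations form a linear system for the numbers [phi]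
   indexed by subsets of the variables.  Its matrix is H_L: applied to the
   vector of the [phi], which starts with F_0, it returns a vector whose only
   nonzero entry is the last one, phi(lambda_0, ..., lambda_(L-1)), that is Z
   times F_0_bar.  H_L is lower Hessenberg with superdiagonal -1, so Cramer's
   rule reads F_0 det H_L = Z F_0_bar. *)

Require Import Defs.
From mathcomp Require Import all_boot all_order all_algebra.
From mathcomp.real_closed Require Import complex.
From mathcomp.reals Require Import reals.
From mathcomp.analysis Require Import sequences exp trigo.
From mathcomp Require Import zify ring.

Set Implicit Arguments.
Unset Strict Implicit.
Unset Printing Implicit Defensive.

Import Order.TTheory GRing.Theory Num.Theory.
Local Open Scope ring_scope.
Local Open Scope complex_scope.

(** * Weights *)

(** The relation for a set O is always taken with x_0 the variable of smallest index in O; it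
    involves [behead O] and the sets obtained from O by removing two elements. This is the origin of
    the alternation with the parity of m. Removing two elements preserves the parity and, in the
    terms N other than those removing the head, may leave lambda_0 in the set, whereas removing the
    head never does. Hence the sets with lambda_0 allowed (m odd) and the sets inside lambda_1, ...,
    lambda_(L-1) (m even) form a family closed under the relations. The relation for all L variables
    contains phi(lambda_1, ..., lambda_(L-1)), which has no column in the matrix; eliminating it by
    its own relation produces the last block row and its factors Lambda(lambda_0). The coefficients
    M and N come from an induction on the number of operators B: moving C past B creates products of
    A and D, and the different ways of reaching the same vector are merged by identities between the
    weights. *)

Section Weights.
Variable R : realType.
Implicit Types u v z : R[i].

Lemma cexpD u v : cexp (u + v) = cexp u * cexp v.
Proof.
case: u v => [a b] [c d]; rewrite /cexp /= expRD cosD sinD.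
by apply/eqP; rewrite eq_complex /=; apply/andP; split; apply/eqP; ring.
Qed.

Lemma cexp0 : cexp 0 = 1 :> R[i].
Proof.
rewrite /cexp /= expR0 cos0 sin0.
by apply/eqP; rewrite eq_complex /= !(mul1r, mul0r, mulr0, subr0, addr0) !eqxx.
Qed.

Lemma cexp_neq0 z : cexp z != 0.
Proof.
apply/eqP => z0; have := cexpD z (- z).
by rewrite subrr z0 mul0r cexp0 => /eqP; rewrite oner_eq0.
Qed.

Lemma cexpN z : cexp (- z) = (cexp z)^-1.
Proof.
by apply: (mulfI (cexp_neq0 z)); rewrite -cexpD subrr cexp0 divff ?cexp_neq0.
Qed.

Variable gamma : R[i].
Local Notation a := (wa gamma).
Local Notation b := (@wb R).
Local Notation c := (wc gamma 0).
Local Notation E := (@cexp R).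

(** These are the functions f = a/b and g = c/b of the exchange relations; [wc] is constant, so its
    argument 0 is arbitrary. *)
Definition weightf u v : R[i] := a (u - v) / b (u - v).
Definition weightg u v : R[i] := c / b (u - v).

Let two_neq0 : 2%:R != 0 :> R[i]. Proof. by rewrite pnatr_eq0. Qed.

(** Up to the factor 1/2, b(u - v) is this difference of squares divided by [E u * E v]. The weights
    thus become rational functions of exponentials, and [field] can decide the identities below with
    such differences as the only denominators to control. *)
Lemma wb_neq0 u v : b (u - v) != 0 -> E u ^+ 2 - E v ^+ 2 != 0.
Proof.
apply: contraNneq => /eqP; rewrite subr_eq0 => /eqP uv; apply/eqP.
rewrite /wb /csinh !(cexpD, cexpN).
have -> : E u / E v - (E u / E v)^-1 = (E u ^+ 2 - E v ^+ 2) / (E u * E v).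
  by field; rewrite !cexp_neq0.
by rewrite uv subrr !mul0r.
Qed.

Lemma weightfE u v : b (u - v) != 0 ->
  weightf u v = (E gamma ^+ 2 * E u ^+ 2 - E v ^+ 2)
                / (E gamma * (E u ^+ 2 - E v ^+ 2)).
Proof.
move=> /wb_neq0 uv; rewrite /weightf /wa /wb /csinh !(cexpD, cexpN).
by field; rewrite !cexp_neq0 uv.
Qed.

Lemma weightgE u v : b (u - v) != 0 ->
  weightg u v = (E gamma ^+ 2 - 1) * E u * E v
                / (E gamma * (E u ^+ 2 - E v ^+ 2)).
Proof.
move=> /wb_neq0 uv; rewrite /weightg /wc /wb /csinh !(cexpD, cexpN).
by field; rewrite !cexp_neq0 uv.
Qed.

Lemma wb_sym u v : (b (u - v) != 0) = (b (v - u) != 0).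
Proof.
have opp t : b (- t) = - b t by rewrite /wb /csinh opprK; field.
by rewrite -(opprB u v) opp oppr_eq0.
Qed.

Lemma weightgC u v : weightg v u = - weightg u v.
Proof.
have opp t : b (- t) = - b t by rewrite /wb /csinh opprK; field.
by rewrite /weightg -(opprB u v) opp invrN mulrN.
Qed.

(* These identities match the coefficients of each off-shell vector in the
   inductive steps of [bethe_expand] and [bethe_C]. *)
Section Identities.
Variables u v w z : R[i].
Hypotheses (uv : b (u - v) != 0) (uw : b (u - w) != 0) (vw : b (v - w) != 0).
Hypotheses (uz : b (u - z) != 0) (vz : b (v - z) != 0).

Let vu : b (v - u) != 0. Proof. by rewrite wb_sym. Qed.
Let wu : b (w - u) != 0. Proof. by rewrite wb_sym. Qed.
Let wv : b (w - v) != 0. Proof. by rewrite wb_sym. Qed.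
Let zu : b (z - u) != 0. Proof. by rewrite wb_sym. Qed.
Let zv : b (z - v) != 0. Proof. by rewrite wb_sym. Qed.

Local Notation f := weightf.
Local Notation g := weightg.

Ltac weights := rewrite ?(weightfE, weightgE) //; field;
  rewrite ?cexp_neq0 ?(wb_neq0 uv) ?(wb_neq0 uw) ?(wb_neq0 vw) ?(wb_neq0 vu)
    ?(wb_neq0 wu) ?(wb_neq0 wv) ?(wb_neq0 uz) ?(wb_neq0 vz) ?(wb_neq0 zu)
    ?(wb_neq0 zv) //.

Lemma weight_A : f v u * g w u - g v u * g w v = g w u * f v w.
Proof. weights. Qed.

Lemma weight_D : f u v * g u w - g u v * g v w = g u w * f w v.
Proof. weights. Qed.

Lemma weight_C1 :
  g w u * f w v * f v u = g w u + g u v * g u w * g u v + g u v * g v w * f v u.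
Proof. weights. Qed.

Lemma weight_C2 : g u w * f u v * f v w = g u w - g u v * f u w * g w v.
Proof. weights. Qed.

Lemma weight_C3 :
  g w u * g u v * f w v = - (g u v * g u w * f u v) - g u v * g v w * g v u.
Proof. weights. Qed.

Lemma weight_C4 :
  g w u * g u z * f w v * f v z
  = g w u * g u z + g u v * g u w * g z v * f u z
    - g u v * g v w * g z u * f v z.
Proof. weights. Qed.

End Identities.
End Weights.

(** * Off-shell Bethe vectors *)

Section BetheVectors.
Variables (F : fieldType) (Q : nat) (I : eqType) (ok : rel I).
Variables (A B C D : I -> 'M[F]_Q) (vac : 'cV[F]_Q) (al de : I -> F).
Variables (f g : I -> I -> F).
Hypotheses (ok_sym : symmetric ok) (ok_irr : irreflexive ok).
Implicit Types (u v w : I) (s t : seq I).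

(** Arguments are labels from an arbitrary [eqType], later positions in a vector, so that removing
    one is a plain filter; [ok] records that the weights of two labels are nondegenerate. *)
Definition bethe s : 'cV[F]_Q := foldr (fun u => mulmx (B u)) vac s.

Lemma bethe_cons u s : bethe (u :: s) = B u *m bethe s. Proof. by []. Qed.
Arguments bethe : simpl never.

Lemma pairwise_ok_uniq s : pairwise ok s -> uniq s.
Proof.
move=> /(sub_pairwise (r' := [rel u v | u != v])); rewrite uniq_pairwise; apply.
by move=> u v /= uv; apply: contraTneq uv => ->; rewrite ok_irr.
Qed.

Definition rm u s := [seq k <- s | k != u].
Arguments rm : simpl never.

Lemma rm_cons u v s : v != u -> rm u (v :: s) = v :: rm u s.
Proof. by rewrite /rm /= => ->. Qed.

Lemma rm_notin u s : u \notin s -> rm u s = s.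
Proof.
by move=> us; apply/all_filterP/allP => v vs; apply: contraNneq us => <-.
Qed.

Lemma rm_head u s : u \notin s -> rm u (u :: s) = s.
Proof. by move=> us; rewrite /rm /= eqxx /= -/(rm u s) rm_notin. Qed.

Lemma bigD1_rm (F0 : I -> F) u s : uniq s -> u \in s ->
  \prod_(k <- s) F0 k = F0 u * \prod_(k <- rm u s) F0 k.
Proof. by move=> us uns; rewrite (bigD1_seq u) //= big_filter. Qed.

Hypothesis BB : forall u v, ok u v -> B u *m B v = B v *m B u.

Section Expansion.
Variables (X : I -> 'M[F]_Q) (xi : I -> F) (h k : I -> I -> F).
Hypothesis XB : forall u v, ok u v ->
  X u *m B v = h v u *: (B v *m X u) - k v u *: (B u *m X v).
Hypothesis Xvac : forall u, X u *m vac = xi u *: vac.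
Hypothesis hk : forall u v w, ok u v -> ok u w -> ok v w ->
  h v u * k w u - k v u * k w v = k w u * h v w.

(** Covers both X = A and X = D. Past [B v], the operator X either keeps u or exchanges it for v; a
    vector lacking p is then reached in two ways, from u directly or through v, and [hk] merges the
    two coefficients. *)
Lemma bethe_expand u s : pairwise ok (u :: s) ->
  X u *m bethe s = (xi u * \prod_(q <- s) h q u) *: bethe s
    - \sum_(p <- s) (xi p * k p u * \prod_(q <- rm p s) h q p)
                     *: bethe (u :: rm p s).
Proof.
elim: s u => [|v s IH] u; first by rewrite !big_nil mulr1 subr0 Xvac.
rewrite !pairwise_cons [all _ (v :: _)]/= => /and3P[/andP[uv us] vs ps].
have uniqs : uniq (v :: s) by apply: pairwise_ok_uniq; rewrite pairwise_cons vs.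
have /andP[vNs unis] : (v \notin s) && uniq s := uniqs.
rewrite bethe_cons mulmxA XB // mulmxBl -!scalemxAl -!mulmxA IH; last first.
  by rewrite pairwise_cons us.
rewrite [X v *m _]IH; last by rewrite pairwise_cons vs.
rewrite !big_cons rm_head // !mulmxBr -!scalemxAr !scalerBr !scalerA.
rewrite !mulmx_sumr !scaler_sumr.
set S1 := \sum_(i <- s) _; set S2 := \sum_(i <- s) _; set S := \sum_(i <- s) _.
have -> : S = S1 - S2.
  rewrite -sumrB; apply: eq_big_seq => p ps'.
  have vp : v != p by apply: contraNneq vNs => ->.
  have [up vpo] := (allP us p ps', allP vs p ps').
  rewrite rm_cons // big_cons -!scalemxAr !scalerA !bethe_cons !mulmxA BB //.
  rewrite -scalerBl; congr (_ *: _).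
  rewrite [RHS](_ : _ = xi p * \prod_(q <- rm p s) h q p
                        * (h v u * k p u - k v u * k p v)); last by ring.
  by rewrite hk //; ring.
rewrite !opprD !opprK !addrA; congr (_ + _); rewrite addrAC; congr (_ - _ - _).
  by congr (_ *: _); ring.
by congr (_ *: _); ring.
Qed.
End Expansion.

Hypothesis AB : forall u v, ok u v ->
  A u *m B v = f v u *: (B v *m A u) - g v u *: (B u *m A v).
Hypothesis DB : forall u v, ok u v ->
  D u *m B v = f u v *: (B v *m D u) - g u v *: (B u *m D v).
Hypothesis CB : forall u v, ok u v ->
  C u *m B v = B v *m C u + g u v *: (A v *m D u - A u *m D v).
Hypothesis Avac : forall u, A u *m vac = al u *: vac.
Hypothesis Dvac : forall u, D u *m vac = de u *: vac.
Hypothesis Cvac : forall u, C u *m vac = 0.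
Hypothesis fgA : forall u v w, ok u v -> ok u w -> ok v w ->
  f v u * g w u - g v u * g w v = g w u * f v w.
Hypothesis fgD : forall u v w, ok u v -> ok u w -> ok v w ->
  f u v * g u w - g u v * g v w = g u w * f w v.
Hypothesis g_anti : forall u v, g v u = - g u v.
Hypothesis fgC1 : forall u v w, ok u v -> ok u w -> ok v w ->
  g w u * f w v * f v u
  = g w u + g u v * g u w * g u v + g u v * g v w * f v u.
Hypothesis fgC2 : forall u v w, ok u v -> ok u w -> ok v w ->
  g u w * f u v * f v w = g u w - g u v * f u w * g w v.
Hypothesis fgC3 : forall u v w, ok u v -> ok u w -> ok v w ->
  g w u * g u v * f w v = - (g u v * g u w * f u v) - g u v * g v w * g v u.
Hypothesis fgC4 : forall u v w z,
  ok u v -> ok u w -> ok v w -> ok u z -> ok v z ->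
  g w u * g u z * f w v * f v z
  = g w u * g u z + g u v * g u w * g z v * f u z
    - g u v * g v w * g z u * f v z.

Lemma mem_rm p q s : (q \in rm p s) = (q != p) && (q \in s).
Proof. by rewrite mem_filter. Qed.

Lemma pairwise_rm p s : pairwise ok s -> pairwise ok (rm p s).
Proof. exact: pairwise_filter. Qed.

Lemma all_rm p (a : pred I) s : all a s -> all a (rm p s).
Proof. by move=> /allP as_; apply/allP => q; rewrite mem_rm => /andP[_ /as_]. Qed.

(* A(v) D(u) on a Bethe vector: D exchanges u with some p of s, then A
   exchanges v with some q; each sum collects the possibilities for the
   removed arguments. *)
Lemma bethe_AD u v s : pairwise ok (u :: v :: s) ->
  A v *m (D u *m bethe s) =
    (al v * de u * \prod_(k <- s) (f u k * f k v)) *: bethe s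
    + \sum_(p <- s)
       ((al u * de p * (g u p * g u v) * \prod_(k <- rm p s) (f p k * f k u)
         - al p * de u * (f u p * g p v) * \prod_(k <- rm p s) (f u k * f k p))
          *: bethe (v :: rm p s)
        - (al v * de p * (g u p * f u v) * \prod_(k <- rm p s) (f p k * f k v))
          *: bethe (u :: rm p s)
        + \sum_(q <- rm p s)
           (al q * de p * (g u p * g q v * f p q * f u q)
            * \prod_(k <- rm q (rm p s)) (f p k * f k q))
           *: bethe (v :: u :: rm q (rm p s))).
Proof.
rewrite !pairwise_cons [all _ (v :: _)]/= => /and3P[/andP[uv us] vs ps].
have uns := pairwise_ok_uniq ps.
rewrite (bethe_expand (h := fun v u => f u v) (k := fun v u => g u v) DB Dvac fgD);
  last by rewrite pairwise_cons us.
rewrite mulmxBr -scalemxAr.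
have EA := bethe_expand (h := f) (k := g) AB Avac fgA.
rewrite EA ?pairwise_cons ?vs //.
rewrite scalerBr scalerA -addrA; congr (_ + _).
  by rewrite big_split /=; congr (_ *: _); ring.
rewrite mulmx_sumr scaler_sumr -opprD -big_split -sumrN /=.
apply: eq_big_seq => p ps'.
have up : u != p by apply: contraTneq (allP us p ps') => ->; rewrite ok_irr.
have usp : u \notin rm p s.
  by rewrite mem_rm; apply/negP => /andP[_ /(allP us)]; rewrite ok_irr.
rewrite -scalemxAr.

rewrite EA; last first.
  rewrite !pairwise_cons [all _ (_ :: _)]/= ok_sym uv !all_rm //=.
  exact: pairwise_rm.
(* The argument u, put into the string by D, can itself be taken up by A: this term gives back the
   vector without p and with v, and joins the single-removal sum. *)
rewrite [X in _ - X](_ : _ = (al u * g u v * \prod_(k <- rm p s) f k u)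
    *: bethe (v :: rm p s)
  + \sum_(q <- rm p s) (al q * g q v * f u q * \prod_(k <- rm q (rm p s)) f k q)
    *: bethe (v :: u :: rm q (rm p s))); last first.
  rewrite big_cons rm_head //; congr (_ + _); apply: eq_big_seq => q qs.
  have uq : u != q by apply: contraNneq usp => ->.
  by rewrite rm_cons // big_cons !mulrA.
rewrite [X in _ = _ + X](_ : _ = (de p * g u p * \prod_(k <- rm p s) f p k) *:
  \sum_(q <- rm p s) (al q * g q v * f u q * \prod_(k <- rm q (rm p s)) f k q)
    *: bethe (v :: u :: rm q (rm p s))); last first.
  rewrite scaler_sumr; apply: eq_big_seq => q qs; rewrite scalerA.
  congr (_ *: _); rewrite (bigD1_rm (f p) (u := q)) ?filter_uniq // big_split /=.
  by ring.
rewrite (bigD1_rm (f u) (u := p)) // big_cons.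
apply/matrixP => i j; rewrite !mxE !big_split /=; ring.
Qed.

(** In every term two arguments among u and s end up in an A and a D acting on the vacuum, since C
    annihilates it. Either u is one of them, giving the first line in its two versions, or A takes q
    and D takes p, and u stays in the string. *)
Lemma bethe_C u s : pairwise ok (u :: s) ->
  C u *m bethe s =
    \sum_(p <- s)
       ((al u * de p * g p u * \prod_(k <- rm p s) (f p k * f k u)
         + al p * de u * g u p * \prod_(k <- rm p s) (f u k * f k p))
          *: bethe (rm p s)
        + \sum_(q <- rm p s)
           (al q * de p * (g p u * g u q * f p q)
            * \prod_(k <- rm q (rm p s)) (f p k * f k q))
           *: bethe (u :: rm q (rm p s))).
Proof.
elim: s => [|v s IH]; first by rewrite big_nil Cvac.
move=> ok_uvs; have := ok_uvs; rewrite !pairwise_cons [all _ (v :: _)]/=.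
case/and3P=> /andP[uv us] vs ps.
have uns := pairwise_ok_uniq ps.
have vNs : v \notin s.
  by apply/negP => /(allP vs); rewrite ok_irr.
rewrite bethe_cons mulmxA CB // mulmxDl -scalemxAl mulmxBl -!mulmxA.
rewrite IH ?pairwise_cons ?us // bethe_AD // bethe_AD; last first.
  by rewrite !pairwise_cons [all _ (_ :: _)]/= ok_sym uv vs us.
rewrite mulmx_sumr [in RHS]big_cons rm_head //.
rewrite opprD addrACA scalerDr addrCA.
rewrite -sumrB scaler_sumr -big_split /= -[RHS]addrA; congr (_ + _).
  by rewrite -scalerBl scalerA (g_anti u v); congr (_ *: _); ring.
rewrite -big_split /=; apply: eq_big_seq => p sp.
have vp : v != p by apply: contraNneq vNs => ->.
have vsp : v \notin rm p s by rewrite mem_rm negb_and vNs orbT.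
have [up vpo] := (allP us p sp, allP vs p sp).
rewrite (rm_cons _ vp) !big_cons rm_head // mulmxDr -scalemxAr -bethe_cons.
pose z q := al q * de p * f p q * \prod_(k <- rm q (rm p s)) (f p k * f k q).
pose w q := bethe (u :: v :: rm q (rm p s)).
have vuE q : bethe [:: v, u & rm q (rm p s)] = w q.
  by rewrite /w !bethe_cons !mulmxA (BB uv).
rewrite mulmx_sumr.
rewrite [X in _ *: _ + X + _ = _](_ : _ = \sum_(q <- rm p s)
    (z q * (g p u * g u q)) *: w q); last first.
  apply: eq_bigr => q _; rewrite -scalemxAr -bethe_cons vuE; congr (_ *: _).
  by rewrite /z; ring.
rewrite [X in _ + _ *: (_ + X - _)](_ : _ = \sum_(q <- rm p s)
    (z q * (g u p * g q v * f u q)) *: w q); last first.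
  by apply: eq_bigr => q _; rewrite vuE /z; congr (_ *: _); ring.
rewrite [X in _ + _ *: (_ - (_ + X))](_ : _ = \sum_(q <- rm p s)
    (z q * (g v p * g q u * f v q)) *: w q); last first.
  by apply: eq_bigr => q _; rewrite /z; congr (_ *: _); ring.
rewrite [X in _ = _ + (_ + (_ + X))](_ : _ = \sum_(q <- rm p s)
    (z q * (g p u * g u q)) *: w q
  + g u v *: (\sum_(q <- rm p s) (z q * (g u p * g q v * f u q)) *: w q
     - \sum_(q <- rm p s) (z q * (g v p * g q u * f v q)) *: w q)); last first.
  rewrite -sumrB scaler_sumr -big_split; apply: eq_big_seq => q qs /=.
  have vq : v != q by apply: contraNneq vsp => ->.
  have sq : q \in s by move: qs; rewrite mem_rm => /andP[].
  rewrite rm_cons // big_cons -/(w q) -!scalerBl scalerA -scalerDl.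
  (* Vectors containing both u and v: the term inherited by induction and the two products of A and
     D add up to the new coefficient. *)
  have I4 := fgC4 uv up vpo (allP us q sq) (allP vs q sq).
  congr (_ *: _); rewrite /z [RHS](_ : _ = al q * de p * f p q *
    \prod_(k <- rm q (rm p s)) (f p k * f k q) *
    (g p u * g u q + g u v * g u p * g q v * f u q - g u v * g v p * g q u * f v q));
    last by ring.
  by rewrite -I4; ring.
set s1 := \sum_(q <- _) _; set s2 := \sum_(q <- _) _; set s3 := \sum_(q <- _) _.
have [I1 I2 I3] := And3 (fgC1 uv up vpo) (fgC2 uv up vpo) (fgC3 uv up vpo).
move: I1 I2 I3; rewrite (g_anti u v) (g_anti u p) (g_anti v p) => I1 I2 I3.
move: (bethe (v :: rm p s)) (bethe (u :: rm p s)) s1 s2 s3 => W1 W2 s1 s2 s3.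
move: (\prod_(k <- rm p s) (f p k * f k u)) => P1.
move: (\prod_(k <- rm p s) (f u k * f k p)) => P2.
move: (\prod_(k <- rm p s) (f p k * f k v)) => P3.
move: (\prod_(k <- rm p s) (f v k * f k p)) => P4.
apply/matrixP => i j; rewrite !mxE.
apply/eqP; rewrite eq_sym -subr_eq0; apply/eqP.
move/eqP: I1; rewrite -subr_eq0 => /eqP I1.
move/eqP: I2; rewrite -subr_eq0 => /eqP I2.
move/eqP: I3; rewrite -subr_eq0 => /eqP I3.
(* What remains is linear in [I1], [I2], [I3]: the first two compare the coefficients of [W1], the
   third those of [W2]. Adding the right multiples of these vanishing expressions leaves a
   polynomial identity; the terms in [P4] match by antisymmetry of g alone. *)
have E1 k := etrans (congr1 ( *%R k) I1) (mulr0 k).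
have E2 k := etrans (congr1 ( *%R k) I2) (mulr0 k).
have E3 k := etrans (congr1 ( *%R k) I3) (mulr0 k).
rewrite -[RHS](E1 (al u * de p * P1 * W1 i j)) -[RHS]addr0.
rewrite -[X in _ = _ + X](E2 (al p * de u * P2 * W1 i j)) -[RHS]addr0.
rewrite -[X in _ = _ + X](E3 (al v * de p * P3 * W2 i j)).
by ring.
Qed.

End BetheVectors.
Arguments rm {I} u s : simpl never.
Arguments bethe {F Q I} B vac s : simpl never.

(** * Yang-Baxter algebra *)

Section RTT.
Variables (F : fieldType) (Q : nat).
Local Notation idx := ('I_2 * 'I_2)%type.

(** The six-vertex R-matrix, with rows and columns indexed by pairs of states so that each tensor
    factor can be addressed separately. *)
Definition R6 (a b c : F) (u v : idx) : F :=
  match val u.1, val u.2, val v.1, val v.2 with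
  | 0, 0, 0, 0 | 1, 1, 1, 1 => a
  | 0, 1, 0, 1 | 1, 0, 1, 0 => b
  | 0, 1, 1, 0 | 1, 0, 0, 1 => c
  | _, _, _, _ => 0
  end.

(* R_{ab} P_a P'_b = P'_b P_a R_{ab}, the two auxiliary spaces being a and b. *)
Definition rtt (r : idx -> idx -> F) (P P' : 'M['M[F]_Q]_2) : Prop :=
  forall u v, \sum_w r u w *: (P w.1 v.1 *m P' w.2 v.2)
            = \sum_w r w v *: (P' u.2 w.2 *m P u.1 w.1).

Lemma mulmx2E (P P' : 'M['M[F]_Q]_2) i k :
  (P * P') i k = \sum_j P i j *m P' j k.
Proof. by rewrite -mulmxE mxE. Qed.

(** Factors attached to different sites commute, so the product regroups as P1 P1' P2 P2' and R is
    carried through the two pairs in turn. *)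
Lemma rtt_mul r (P1 P2 P1' P2' : 'M['M[F]_Q]_2) :
  rtt r P1 P1' -> rtt r P2 P2' ->
  (forall i j k l, P2 i j *m P1' k l = P1' k l *m P2 i j) ->
  (forall i j k l, P2' i j *m P1 k l = P1 k l *m P2' i j) ->
  rtt r (P1 * P2) (P1' * P2').
Proof.
move=> r1 r2 c1 c2 u v.
have E1 w : ((P1 * P2) w.1 v.1 : 'M_Q) *m (P1' * P2') w.2 v.2
    = \sum_t (P1 w.1 t.1 *m P1' w.2 t.2) *m (P2 t.1 v.1 *m P2' t.2 v.2).
  rewrite !mulmx2E mulmx_suml.
  under eq_bigr => i _ do rewrite mulmx_sumr.
  rewrite pair_bigA /=; apply: eq_bigr => -[i j] _ /=.
  by rewrite !mulmxA; congr (_ *m _); rewrite -!mulmxA c1.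
have E2 w : ((P1' * P2') u.2 w.2 : 'M_Q) *m (P1 * P2) u.1 w.1
    = \sum_t (P1' u.2 t.2 *m P1 u.1 t.1) *m (P2' t.2 w.2 *m P2 t.1 w.1).
  rewrite !mulmx2E mulmx_suml.
  under eq_bigr => i _ do rewrite mulmx_sumr.
  rewrite exchange_big pair_bigA /=; apply: eq_bigr => -[i j] _ /=.
  by rewrite !mulmxA; congr (_ *m _); rewrite -!mulmxA c2.
under eq_bigr => w _ do rewrite E1 scaler_sumr.
under [RHS]eq_bigr => w _ do rewrite E2 scaler_sumr.
rewrite exchange_big /=.
transitivity (\sum_t \sum_w r w t *:
   (P1' u.2 w.2 *m P1 u.1 w.1 *m (P2 t.1 v.1 *m P2' t.2 v.2))).
  apply: eq_bigr => t _.
  transitivity ((\sum_w r u w *: (P1 w.1 t.1 *m P1' w.2 t.2))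
                *m (P2 t.1 v.1 *m P2' t.2 v.2)).
    by rewrite mulmx_suml; apply: eq_bigr => w _; rewrite -scalemxAl.
  by rewrite r1 mulmx_suml; apply: eq_bigr => w _; rewrite -scalemxAl.
rewrite exchange_big [RHS]exchange_big /=; apply: eq_bigr => w _.
transitivity (P1' u.2 w.2 *m P1 u.1 w.1
              *m (\sum_t r w t *: (P2 t.1 v.1 *m P2' t.2 v.2))).
  by rewrite mulmx_sumr; apply: eq_bigr => t _; rewrite -scalemxAr.
by rewrite r2 mulmx_sumr; apply: eq_bigr => t _; rewrite -scalemxAr.
Qed.

Lemma rtt1 r : rtt r 1 1.
Proof.
have one (i j k l : 'I_2) :
    ((1 : 'M['M[F]_Q]_2) i j *m (1 : 'M['M[F]_Q]_2) k l : 'M[F]_Q)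
    = ((i == j) && (k == l))%:R%:M.
  by rewrite !mxE; case: eqP; case: eqP; rewrite ?(mulmx0, mul0mx, mulmx1) // raddf0.
move=> [u1 u2] [v1 v2] /=.
under eq_bigr => w _ do rewrite one -scalemx1 scalerA.
under [RHS]eq_bigr => w _ do rewrite one -scalemx1 scalerA.
rewrite (bigD1 (v1, v2)) //= [RHS](bigD1 (u1, u2)) //= !eqxx.
rewrite !big1 // => -[w1 w2] wu; move: wu; rewrite xpair_eqE.
  by rewrite andbC [u2 == _]eq_sym [u1 == _]eq_sym andbC => /negPf ->; rewrite mulr0 scale0r.
by move=> /negPf -> ; rewrite mulr0 scale0r.
Qed.

Lemma sum_ord2 (V : nmodType) (G : 'I_2 -> V) : \sum_i G i = G ord0 + G ord_max.
Proof.
rewrite big_ord_recl big_ord1; congr (_ + G _); exact: val_inj.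
Qed.

Lemma ord2P (i : 'I_2) : i = ord0 \/ i = ord_max.
Proof. by case: i => [[|[|//]] ?]; [left|right]; apply: val_inj. Qed.

Lemma sum_idx (V : nmodType) (G : idx -> V) : \sum_w G w
  = G (ord0, ord0) + G (ord0, ord_max) + (G (ord_max, ord0) + G (ord_max, ord_max)).
Proof.
transitivity (\sum_i \sum_j G (i, j)); last by rewrite !sum_ord2.
by rewrite pair_bigA; apply: eq_bigr => -[].
Qed.

Section Exchange.
Variables (a b c : F) (P P' : 'M['M[F]_Q]_2).
Hypotheses (rttP : rtt (R6 a b c) P P') (b0 : b != 0).

(** This exchange relation and the next three are single entries (u, v) of [rtt], solved for one
    product. *)
Lemma rtt_BB : a != 0 -> P ord0 ord_max *m P' ord0 ord_max
                         = P' ord0 ord_max *m P ord0 ord_max.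
Proof.
move=> a0; have := rttP (ord0, ord0) (ord_max, ord_max).
by rewrite !sum_idx /R6 /= !scale0r !addr0 !add0r => /(scalerI a0).
Qed.

Lemma rtt_AB : P' ord0 ord0 *m P ord0 ord_max
  = (a / b) *: (P ord0 ord_max *m P' ord0 ord0)
    - (c / b) *: (P' ord0 ord_max *m P ord0 ord0).
Proof.
have := rttP (ord0, ord0) (ord_max, ord0).
rewrite !sum_idx /R6 /= !scale0r !addr0 !add0r => E.
apply: (scalerI b0); rewrite scalerBr !scalerA !(mulrC b) !divfK // E.
by rewrite addrAC subrr add0r.
Qed.

Lemma rtt_DB : P ord_max ord_max *m P' ord0 ord_max
  = (a / b) *: (P' ord0 ord_max *m P ord_max ord_max)
    - (c / b) *: (P ord0 ord_max *m P' ord_max ord_max).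
Proof.
have := rttP (ord_max, ord0) (ord_max, ord_max).
rewrite !sum_idx /R6 /= !scale0r !addr0 !add0r => E.
apply: (scalerI b0); rewrite scalerBr !scalerA !(mulrC b) !divfK // -E.
by rewrite addrAC subrr add0r.
Qed.

Lemma rtt_CB : P ord_max ord0 *m P' ord0 ord_max
  = P' ord0 ord_max *m P ord_max ord0
    + (c / b) *: (P' ord0 ord0 *m P ord_max ord_max
                  - P ord0 ord0 *m P' ord_max ord_max).
Proof.
have := rttP (ord_max, ord0) (ord0, ord_max).
rewrite !sum_idx /R6 /= !scale0r !addr0 !add0r => E.
apply: (scalerI b0); rewrite scalerDr !scalerA !(mulrC b) !divfK //.
rewrite scalerBr addrA -E.
by rewrite addrAC subrr add0r.
Qed.

End Exchange.

(** In multiplicative parameters the Yang-Baxter equation is a rational identity, checked on all 64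
    choices of boundary states. *)
Lemma yang_baxter (p q g : F) (u v : idx) (e e' : 'I_2) :
  p != 0 -> q != 0 -> g != 0 -> 2%:R != 0 :> F ->
  let R x := R6 ((x * g - (x * g)^-1) / 2%:R) ((x - x^-1) / 2%:R) ((g - g^-1) / 2%:R) in
  \sum_w R (p / q) u w *
     (\sum_t R p (w.1, e) (v.1, t) * R q (w.2, t) (v.2, e'))
  = \sum_w R (p / q) w v *
     (\sum_t R q (u.2, e) (w.2, t) * R p (u.1, t) (w.1, e')).
Proof.
move=> p0 q0 g0 two0 R; case: u v => [u1 u2] [v1 v2].
rewrite !sum_idx !sum_ord2 /R.
case: (ord2P u1) => ->; case: (ord2P u2) => ->; case: (ord2P v1) => ->;
case: (ord2P v2) => ->; case: (ord2P e) => ->; case: (ord2P e') => ->;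
rewrite /R6 /= ?(mul0r, mulr0, addr0, add0r) //; field; rewrite ?p0 ?q0 ?g0 ?two0 //.
Qed.
End RTT.

(** * Monodromy matrix *)

Section Sites.
Variables (R : realType) (L : nat).
Local Notation K := (R[i]).
Local Notation Q := #|{: config L}|.
Implicit Types (j k : 'I_L) (E G : 'M[K]_2) (p q : 'I_Q).

Definition upd (x : config L) j (b : 'I_2) : config L :=
  [ffun k => if k == j then b else x k].

Lemma sum_config (V : nmodType) (H : 'I_Q -> V) :
  \sum_p H p = \sum_(x : config L) H (enum_rank x).
Proof. by rewrite (reindex (@enum_rank _)) //; apply/onW_bij/enum_rank_bij. Qed.

Lemma siteE j E (x y : config L) :
  site j E (enum_rank x) (enum_rank y)
  = if [forall k, (k != j) ==> (x k == y k)] then E (x j) (y j) else 0.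
Proof. by rewrite mxE !enum_rankK. Qed.

Lemma agree_upd j (x y : config L) :
  [forall k, (k != j) ==> (x k == y k)] = (y == upd x j (y j)).
Proof.
apply/forallP/eqP => [xy|-> k]; last first.
  by rewrite ffunE; apply/implyP => /negPf ->.
apply/ffunP => k; rewrite ffunE; have := xy k.
by case: eqVneq => [->|_ /eqP].
Qed.

Lemma agree_sym j (x y : config L) :
  [forall k, (k != j) ==> (x k == y k)] = [forall k, (k != j) ==> (y k == x k)].
Proof. by apply: eq_forallb => k; rewrite [x k == _]eq_sym. Qed.

Lemma site_mul j E G : site j E *m site j G = site j (E *m G).
Proof.
apply/matrixP => p q; rewrite -(enum_valK p) -(enum_valK q).
move: (enum_val p) (enum_val q) => x y.
rewrite mxE sum_config siteE (bigID (fun z : config L => z == upd x j (z j))) /=.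
rewrite [X in _ + X]big1 ?addr0 => [|z]; last first.
  by rewrite siteE agree_upd => /negPf ->; rewrite mul0r.
have uj b : upd x j b j = b by rewrite ffunE eqxx.
(* The intermediate configurations agreeing with x off j are parametrised by their value at j, which
   turns the sum into a product of 2 x 2 matrices. *)
rewrite (reindex_onto (fun b => upd x j b) (fun z : config L => z j)) /=; last first.
  by move=> z /eqP/esym.
under eq_bigl => b do rewrite uj !eqxx.
under eq_bigr => b _ do rewrite !siteE agree_upd uj eqxx.
have agree b : [forall k, (k != j) ==> (upd x j b k == y k)]
             = [forall k, (k != j) ==> (x k == y k)].
  by apply: eq_forallb => k; rewrite ffunE; case: eqP.
under eq_bigr => b _ do rewrite agree.
case: ifP => _; first by rewrite mxE.
by rewrite big1 // => b _; rewrite mulr0.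
Qed.

Lemma site_comm j k E G : j != k ->
  site j E *m site k G = site k G *m site j E.
Proof.
have mulE j' k' E' G' (x y : config L) : j' != k' ->
    (site j' E' *m site k' G') (enum_rank x) (enum_rank y)
    = if [forall l, (l != j') && (l != k') ==> (x l == y l)]
      then E' (x j') (y j') * G' (x k') (y k') else 0.
  (* The only intermediate configuration that contributes is x with its value at j' already changed
     to that of y. The resulting entry is symmetric in the two sites. *)
  move=> jk; rewrite mxE sum_config (bigD1 (upd x j' (y j'))) //= big1 ?addr0.
    rewrite !siteE agree_upd ffunE eqxx eqxx ffunE eq_sym (negPf jk).
    rewrite (_ : [forall l, _] = [forall l, (l != j') && (l != k') ==> (x l == y l)]).
      by case: ifP => _; rewrite ?mulr0.
    apply: eq_forallb => l; rewrite ffunE.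
    by have [->|] := eqVneq l j'; rewrite ?eqxx ?implybT //= jk.
  move=> z zN; rewrite !siteE agree_upd; case: eqP => [zE|_]; last by rewrite mul0r.
  case: ifP => [/forallP/(_ j')|_]; last by rewrite mulr0.
  by rewrite jk /= => /eqP zy; case/eqP: zN; rewrite zE zy.
move=> jk; apply/matrixP => p q; rewrite -(enum_valK p) -(enum_valK q).
rewrite mulE // [RHS]mulE 1?eq_sym // [X in _ = if _ then X else _]mulrC.
congr (if _ then _ else _).
by apply: eq_forallb => l; rewrite [(l != j) && _]andbC.
Qed.

Lemma siteZ j (a : K) E : a *: site j E = site j (a *: E).
Proof.
apply/matrixP => p q; rewrite !mxE /=.
by case: ifP => _; rewrite ?mxE ?mulr0.
Qed.

Lemma site_sum j (I : finType) (E : I -> 'M[K]_2) :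
  \sum_i site j (E i) = site j (\sum_i E i).
Proof.
apply/matrixP => p q; rewrite summxE !mxE /=.
under eq_bigr => i _ do rewrite mxE /=.
by case: ifP => _; rewrite ?summxE // big1.
Qed.

Lemma site_vac j E : E ord_max ord0 = 0 ->
  site j E *m vac R L = E ord0 ord0 *: vac R L.
Proof.
move=> E0; apply/matrixP => p q; rewrite -(enum_valK p).
move: (enum_val p) => x.
rewrite mxE (bigD1 (enum_rank ([ffun=> ord0] : config L))) //= big1 ?addr0.
  rewrite siteE !mxE eqxx (ord1 q) eqxx !ffunE mulr1 agree_sym agree_upd.
  rewrite andbT (inj_eq enum_rank_inj).
  have [->|] := eqVneq x [ffun=> ord0].
    rewrite ffunE mulr1 ifT //; apply/eqP/ffunP => k; rewrite !ffunE.
    by case: ifP.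
  case: (ord2P (x j)) => xj; rewrite xj => x0; last by rewrite E0 if_same mulr0.
  rewrite mulr0 ifF //; apply: contraNF x0 => /eqP ->.
  by apply/eqP/ffunP => k; rewrite !ffunE; case: ifP.
by move=> p' /negPf p'N; rewrite [X in _ * X]mxE p'N mulr0.
Qed.

End Sites.

Section Monodromy.
Variables (R : realType) (L : nat) (gamma : R[i]) (mu : L.-tuple R[i]).
Local Notation K := (R[i]).
Local Notation Q := #|{: config L}|.
Local Notation E := (@cexp R).

Definition Rweights (u : K) := R6 (wa gamma u) (wb u) (wc gamma u).

Definition lax (u : K) (al al' : 'I_2) : 'M[K]_2 :=
  \matrix_(be, be') Rweights u (al, be) (al', be').

Lemma RauxE (j : 'I_L) u al al' : Raux gamma j u al al' = site j (lax u al al').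
Proof.
rewrite mxE; congr (site j _); apply/matrixP => be be'; rewrite !mxE /Rweights.
by case: (ord2P al) => ->; case: (ord2P al') => ->; case: (ord2P be) => ->;
  case: (ord2P be') => ->; rewrite !inordK.
Qed.

Lemma Raux_comm (j k : 'I_L) u v al al' be be' : j != k ->
  Raux gamma j u al al' *m Raux gamma k v be be'
  = Raux gamma k v be be' *m Raux gamma j u al al'.
Proof. by move=> jk; rewrite !RauxE site_comm. Qed.

(** All operators involved act on the one site j, so this is the Yang-Baxter equation with that site
    as third space. *)
Lemma rtt_Raux (j : 'I_L) u v m :
  rtt (Rweights (u - v)) (Raux gamma j (u - m)) (Raux gamma j (v - m)).
Proof.
move=> i k.
under eq_bigr => w _ do rewrite !RauxE site_mul siteZ.
under [RHS]eq_bigr => w _ do rewrite !RauxE site_mul siteZ.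
rewrite !site_sum; congr (site j _); apply/matrixP => e e'.
have two0 : 2%:R != 0 :> K by rewrite pnatr_eq0.
have := yang_baxter i k e e' (cexp_neq0 (u - m)) (cexp_neq0 (v - m))
          (cexp_neq0 gamma) two0.
have RE t : Rweights t = R6 ((E t * E gamma - (E t * E gamma)^-1) / 2%:R)
   ((E t - (E t)^-1) / 2%:R) ((E gamma - (E gamma)^-1) / 2%:R).
  by rewrite /Rweights /wa /wb /wc /csinh !(cexpN, cexpD).
have uvE : E (u - m) / E (v - m) = E (u - v).
  by rewrite -cexpN -cexpD; congr cexp; ring.
rewrite /= uvE -!RE => yb.
rewrite !summxE; transitivity (\sum_w Rweights (u - v) i w *
     (\sum_t Rweights (u - m) (w.1, e) (k.1, t) * Rweights (v - m) (w.2, t) (k.2, e'))).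
  apply: eq_bigr => w _; rewrite !mxE; congr (_ * _).
  by apply: eq_bigr => t _; rewrite !mxE.
rewrite yb; apply: eq_bigr => w _; rewrite !mxE; congr (_ * _).
by apply: eq_bigr => t _; rewrite !mxE.
Qed.

(** A product over any list of sites allows induction; a site outside the list commutes with it. *)
Definition partial_monodromy (s : seq 'I_L) (u : K) : 'M['M[K]_Q]_2 :=
  \prod_(j <- s) Raux gamma j (u - tnth mu j).

Lemma partial_cons (j : 'I_L) s u i k :
  partial_monodromy (j :: s) u i k
  = \sum_l Raux gamma j (u - tnth mu j) i l *m partial_monodromy s u l k.
Proof. by rewrite {1}/partial_monodromy big_cons mulmx2E. Qed.

Lemma Raux_comm_partial s (j : 'I_L) u v al al' be be' : j \notin s ->
  partial_monodromy s v be be' *m Raux gamma j u al al'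
  = Raux gamma j u al al' *m partial_monodromy s v be be'.
Proof.
elim: s be be' => [|k s IH] be be'.
  move=> _; rewrite /partial_monodromy big_nil mxE.
  by case: eqP => _; rewrite ?(mulmx1, mul1mx, mulmx0, mul0mx).
rewrite in_cons negb_or => /andP[jk js].
rewrite partial_cons mulmx_suml mulmx_sumr; apply: eq_bigr => i _.
rewrite -mulmxA (IH i be' js) !mulmxA; congr (_ *m _).
by apply: Raux_comm; rewrite eq_sym.
Qed.

Lemma rtt_partial s u v : uniq s ->
  rtt (Rweights (u - v)) (partial_monodromy s u) (partial_monodromy s v).
Proof.
elim: s => [|j s IH] /=.
  by rewrite /partial_monodromy !big_nil => _; apply: rtt1.
case/andP=> js us; rewrite /partial_monodromy !big_cons.
apply: rtt_mul; [exact: rtt_Raux | exact: IH | |] => *;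
  exact: Raux_comm_partial.
Qed.

Local Notation v0 := (vac R L).

Lemma partial_vac s u : uniq s ->
  [/\ partial_monodromy s u ord_max ord0 *m v0 = 0,
      partial_monodromy s u ord0 ord0 *m v0
        = (\prod_(j <- s) wa gamma (u - tnth mu j)) *: v0 &
      partial_monodromy s u ord_max ord_max *m v0
        = (\prod_(j <- s) wb (u - tnth mu j)) *: v0].
Proof.
elim: s => [|j s IH] /=.
  by rewrite /partial_monodromy !big_nil !mxE /= !(mul0mx, mul1mx, scale1r).
case/andP=> js /IH[C0 A0 D0].
have PE i k : partial_monodromy (j :: s) u i k
    = Raux gamma j (u - tnth mu j) i ord0 *m partial_monodromy s u ord0 k
    + Raux gamma j (u - tnth mu j) i ord_max *m partial_monodromy s u ord_max k.
  by rewrite partial_cons sum_ord2.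
have site0 : Raux gamma j (u - tnth mu j) ord_max ord0 *m v0 = 0.
  by rewrite RauxE site_vac !mxE //= scale0r.
rewrite !PE !mulmxDl -!mulmxA C0 A0 D0 !mulmx0 !addr0 -!scalemxAr site0 scaler0.
(* The entry B of the other sites creates vectors outside the line of the vacuum, but it commutes
   with the lower-left entry at site j, which kills the vacuum. *)
rewrite [X in X + _ = _](_ : _ = 0); last first.
  by rewrite mulmxA -Raux_comm_partial // -mulmxA site0 mulmx0.
rewrite add0r.
rewrite !RauxE !site_vac ?mxE //= !scalerA !big_cons.
by split=> //; congr (_ *: _); rewrite mulrC.
Qed.

Lemma monodromy_rtt u v :
  rtt (Rweights (u - v)) (monodromy gamma mu u) (monodromy gamma mu v).
Proof.
have := @rtt_partial (index_enum 'I_L) u v (index_enum_uniq _).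
by rewrite /partial_monodromy.
Qed.

Definition opA (u : K) : 'M[K]_Q := monodromy gamma mu u ord0 ord0.
Definition opD (u : K) : 'M[K]_Q := monodromy gamma mu u ord_max ord_max.
Local Notation B := (opB gamma mu).
Local Notation Cc := (opC gamma mu).
Local Notation f := (weightf gamma).
Local Notation g := (weightg gamma).

Lemma opB_comm u v : wa gamma (u - v) != 0 -> B u *m B v = B v *m B u.
Proof. exact: rtt_BB (monodromy_rtt u v). Qed.

(** In the RTT entry used here A belongs to the second auxiliary space, in contrast to D in [opDB];
    hence u and v are interchanged and the weights depend on v - u. *)
Lemma opAB u v : wb (u - v) != 0 ->
  opA u *m B v = f v u *: (B v *m opA u) - g v u *: (B u *m opA v).
Proof. by rewrite wb_sym; apply: rtt_AB (monodromy_rtt v u). Qed.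

Lemma opDB u v : wb (u - v) != 0 ->
  opD u *m B v = f u v *: (B v *m opD u) - g u v *: (B u *m opD v).
Proof. exact: rtt_DB (monodromy_rtt u v). Qed.

Lemma opCB u v : wb (u - v) != 0 ->
  Cc u *m B v = B v *m Cc u + g u v *: (opA v *m opD u - opA u *m opD v).
Proof. exact: rtt_CB (monodromy_rtt u v). Qed.

Lemma opC_vac u : Cc u *m v0 = 0.
Proof. by have [] := @partial_vac (index_enum 'I_L) u (index_enum_uniq _). Qed.

Lemma opA_vac u : opA u *m v0 = (\prod_(m <- mu) wa gamma (u - m)) *: v0.
Proof.
have [_ + _] := @partial_vac (index_enum 'I_L) u (index_enum_uniq _).
by rewrite big_tuple.
Qed.

Lemma opD_vac u : opD u *m v0 = (\prod_(m <- mu) wb (u - m)) *: v0.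
Proof.
have [_ _] := @partial_vac (index_enum 'I_L) u (index_enum_uniq _).
by rewrite big_tuple.
Qed.

End Monodromy.

(** * Functional relations *)

Lemma del_rm i s : uniq s -> (i < size s)%N -> del i.+1 s = rm (nth 0%N s i) s.
Proof.
move=> us si; rewrite /rm -(rem_filter _ us) remE index_uniq //.
Qed.

Lemma map_del (f : nat -> nat) i s : map f (del i s) = del i (map f s).
Proof. by rewrite /del map_cat map_take map_drop. Qed.

Lemma map_del2 (f : nat -> nat) i j s : map f (del2 i j s) = del2 i j (map f s).
Proof. by rewrite /del2 !map_del. Qed.

Lemma rmC p q (s : seq nat) : rm p (rm q s) = rm q (rm p s).
Proof. by rewrite /rm -!filter_predI; apply: eq_filter => k /=; rewrite andbC. Qed.

Lemma del2_iota k l n : (k < l)%N -> (l <= n)%N ->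
  del2 k.+1 l.+1 (iota 0 n.+1) = rm k (rm l (iota 0 n.+1)).
Proof.
move=> kl ln; rewrite /del2 (@del_rm l (iota 0 n.+1)) ?iota_uniq ?size_iota // nth_iota //.
(* Removing l leaves the entries before it in place, so position k still holds k. *)
have take_rm : take l (rm l (iota 0 n.+1)) = iota 0 l.
  have -> : (n.+1 = l + (n.+1 - l))%N by lia.
  rewrite iotaD /rm filter_cat (_ : [seq k <- iota 0 l | k != l] = iota 0 l).
    by rewrite take_size_cat ?size_iota.
  apply/all_filterP/allP => i; rewrite mem_iota add0n => /andP[_].
  by rewrite neq_ltn => ->.
have szl : (l <= size (rm l (iota 0 n.+1)))%N.
  by rewrite -[X in (X <= _)%N](size_iota 0 l) -take_rm size_take; case: ltnP => [/ltnW|].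
rewrite del_rm ?(filter_uniq, iota_uniq) //; last exact: leq_trans kl szl.
by rewrite -(nth_take 0%N kl) take_rm nth_iota.
Qed.

(** Groups the two orders of a pair of removed arguments, which yield the two summands of
    [coefN]. *)
Lemma sum_offdiag (V : nmodType) n (H : nat -> nat -> V) :
  \sum_(p <- iota 1 n) \sum_(q <- rm p (iota 1 n)) H p q
  = \sum_(1 <= k < n.+1) \sum_(k.+1 <= l < n.+1) (H l k + H k l).
Proof.
have iotaE : iota 1 n = index_iota 1 n.+1 by rewrite /index_iota subn1.
under [RHS]eq_bigr => k _ do rewrite big_split (big_nat_widenl _ 1%N) //.
rewrite big_split /= (exchange_big_dep_nat xpredT) //= -big_split /= iotaE.
apply: eq_bigr => p _; rewrite big_filter (bigID (fun q => (q < p)%N)) /=.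
congr (_ + _).
  by apply: eq_bigl => q; rewrite andbC; case: ltngtP.
rewrite [RHS](big_nat_widenl _ 1%N) //; apply: eq_bigl => q.
by rewrite /=; case: ltngtP.
Qed.

Section FunctionalRelation.
Variables (R : realType) (L : nat) (gamma : R[i]) (mu : L.-tuple R[i]).
Local Notation K := (R[i]).
Local Notation Q := #|{: config L}|.
Variables (Lambda : K -> K) (bra : 'rV[K]_Q).
Hypothesis bra_eigen : forall u, bra *m transfer gamma mu u = Lambda u *: bra.

(** The function b is odd, so one sign suffices for it; a is not, and [coefN] divides by it in both
    directions. *)
Definition generic_pair (u v : K) : bool :=
  [&& wa gamma (u - v) != 0, wa gamma (v - u) != 0 & wb (u - v) != 0].

Definition bethe_coef (s : seq K) : K :=
  (bra *m bethe (opB gamma mu) (vac R L) s) 0 0.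

Lemma bethe_map (I : eqType) (x : I -> K) s :
  bethe (fun i => opB gamma mu (x i)) (vac R L) s
  = bethe (opB gamma mu) (vac R L) (map x s).
Proof. by elim: s => // i s IH; rewrite /= !bethe_cons IH. Qed.

Let al u := \prod_(m <- mu) wa gamma (u - m).
Let de u := \prod_(m <- mu) wb (u - m).

Lemma bethe_C_pos n (x : seq K) : size x = n.+1 -> pairwise generic_pair x ->
  let W s := bethe (opB gamma mu) (vac R L) [seq x`_k | k <- s] in
  opC gamma mu x`_0 *m W (iota 1 n)
  = \sum_(1 <= k < n.+1) Defs.coefM gamma mu n k x *: W (rm k (iota 1 n))
    + \sum_(1 <= k < n.+1) \sum_(k.+1 <= l < n.+1)
       Defs.coefN gamma mu n l k x *: W (0%N :: rm k (rm l (iota 1 n))).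
Proof.
move=> sx gx W.
pose ok (i j : nat) := (i != j) && generic_pair x`_i x`_j.
have ok_sym : symmetric ok.
  by move=> i j; rewrite /ok eq_sym /generic_pair wb_sym; congr (_ && _); rewrite andbCA.
have ok_irr : irreflexive ok by move=> i; rewrite /ok eqxx.
have okb i j : ok i j -> wb (x`_i - x`_j) != 0 by case/and4P.
have oka i j : ok i j -> wa gamma (x`_i - x`_j) != 0 by case/and4P.
have okP i j : (i < j)%N -> (j <= n)%N -> ok i j.
  move=> ij jn; rewrite /ok (ltn_eqF ij).
  by move/(pairwiseP 0): gx; apply; rewrite // inE sx ltnS // (leq_trans (ltnW ij)).
have ok_iota : pairwise ok (iota 0 n.+1).
  apply/(pairwiseP 0%N) => i j; rewrite !inE size_iota => ni nj ij.
  by rewrite !nth_iota //; apply: okP.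
pose f i j := weightf gamma x`_i x`_j.
pose g i j := weightg gamma x`_i x`_j.
have BC := @bethe_C _ _ _ ok (fun i => opA gamma mu x`_i) (fun i => opB gamma mu x`_i)
  (fun i => opC gamma mu x`_i) (fun i => opD gamma mu x`_i) (vac R L)
  (fun i => al x`_i) (fun i => de x`_i) f g ok_sym ok_irr
  (fun i j ij => opB_comm mu (oka i j ij)) (fun i j ij => opAB gamma mu (okb i j ij))
  (fun i j ij => opDB gamma mu (okb i j ij)) (fun i j ij => opCB gamma mu (okb i j ij))
  (fun i => opA_vac gamma mu x`_i) (fun i => opD_vac gamma mu x`_i)
  (fun i => opC_vac gamma mu x`_i)
  (fun i j k ij ik jk => weight_A gamma (okb i j ij) (okb i k ik) (okb j k jk))
  (fun i j k ij ik jk => weight_D gamma (okb i j ij) (okb i k ik) (okb j k jk))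
  (fun i j => weightgC gamma x`_i x`_j)
  (fun i j k ij ik jk => weight_C1 gamma (okb i j ij) (okb i k ik) (okb j k jk))
  (fun i j k ij ik jk => weight_C2 gamma (okb i j ij) (okb i k ik) (okb j k jk))
  (fun i j k ij ik jk => weight_C3 gamma (okb i j ij) (okb i k ik) (okb j k jk))
  (fun i j k l ij ik jk il jl => weight_C4 gamma (okb i j ij) (okb i k ik) (okb j k jk)
     (okb i l il) (okb j l jl))
  0%N (iota 1 n) ok_iota.
have WE s : W s = bethe (fun i => opB gamma mu x`_i) (vac R L) s by rewrite bethe_map.
rewrite WE BC big_split /= sum_offdiag.
have iotaE : iota 1 n = index_iota 1 n.+1 by rewrite /index_iota subn1.
have prodMu u v : \prod_(m <- mu) (wa gamma (u - m) * wb (v - m)) = al u * de v.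
  by rewrite big_split.
congr (_ + _).
  rewrite iotaE; apply: eq_bigr => p _; rewrite WE; congr (_ *: _).
  rewrite /Defs.coefM !prodMu !big_filter /f /g /weightf /weightg /wc /=.
  by ring.
apply: eq_big_nat => k /andP[k1 _]; apply: eq_big_nat => l /andP[kl ln].
have [k0 l0] : k != 0%N /\ l != 0%N by lia.
(* The factor of index 0 in [coefN] has numerators that cancel the denominators a in front, leaving
   the two factors g of [bethe_C]. *)
have prodE (F : nat -> K) :
  \prod_(0 <= i < n.+1 | (i != k) && (i != l)) F i
  = F 0%N * \prod_(i <- rm l (rm k (iota 1 n))) F i.
  rewrite big_ltn_cond // !(eq_sym 0%N) k0 l0 /rm -filter_predI big_filter -iotaE.
  by congr (_ * _); apply: eq_bigl => i /=; rewrite andbC.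
rewrite /Defs.coefN !prodE (rmC k l).
have [ok0k ok0l okkl] := And3 (okP 0%N k k1 (leq_trans (ltnW kl) ln))
  (okP 0%N l (ltn_trans k1 kl) ln) (okP k l kl ln).
have symN i j (ij : ok i j) : [/\ wa gamma (x`_i - x`_j) != 0,
   wa gamma (x`_j - x`_i) != 0, wb (x`_i - x`_j) != 0 & wb (x`_j - x`_i) != 0].
  by split; [apply: oka|apply: oka|apply: okb|apply: okb]; rewrite // ok_sym.
have [[a1 a2 b1 b2] [a3 a4 b3 b4] [_ _ b5 b6]] :=
  And3 (symN _ _ ok0k) (symN _ _ ok0l) (symN _ _ okkl).
rewrite WE -scalerDl; congr (_ *: _).
rewrite !prodMu.
move: (\prod_(q <- _) (f l q * f q k)) (\prod_(q <- _) (f k q * f q l)) => P1 P2.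
move: (al _) (al _) (de _) (de _) => p1 p2 p3 p4.
rewrite /f /g /weightf /weightg /wc.
by field; rewrite a1 a2 a3 a4 b1 b2 b3 b4 b5 b6.
Qed.

(** Labels O and values y are kept apart because [del2] acts on sequences of indices. *)
Lemma functional_relation (y : nat -> K) (O : seq nat) n :
  size O = n.+1 -> pairwise generic_pair (map y O) ->
  let x := map y O in
  bethe_coef x = Lambda x`_0 * bethe_coef (behead x)
    - \sum_(1 <= k < n.+1) Defs.coefM gamma mu n k x * bethe_coef (map y (del2 1 k.+1 O))
    - \sum_(1 <= k < n.+1) \sum_(k.+1 <= l < n.+1)
        Defs.coefN gamma mu n l k x * bethe_coef (map y (del2 k.+1 l.+1 O)).
Proof.
move=> sO gO x.
have sx : size x = n.+1 by rewrite size_map.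
have xE i j : (i < j)%N -> (j <= n)%N ->
    [seq x`_k | k <- rm i (rm j (iota 0 n.+1))] = map y (del2 i.+1 j.+1 O).
  move=> ij jn; rewrite -[in RHS](mkseq_nth 0%N O) sO /mkseq -map_del2 -map_comp.
  rewrite -del2_iota //; apply/eq_in_map => k; rewrite del2_iota // !mem_rm mem_iota add0n.
  by move=> /and3P[_ _ /andP[_ kn]]; rewrite /= (nth_map 0%N) // sO.
have x1 : [seq x`_k | k <- iota 1 n] = behead x.
  rewrite -{2}(mkseq_nth 0 x) sx /mkseq /= //.
have rm0 k : rm 0%N (0%N :: rm k (iota 1 n)) = rm k (iota 1 n).
  by rewrite rm_head // mem_rm mem_iota andbF.
have := congr1 (fun v : 'cV_Q => (bra *m v) 0 0) (bethe_C_pos sx gO).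
rewrite x1 => relC.
have relT : (bra *m (transfer gamma mu x`_0 *m bethe (opB gamma mu) (vac R L) (behead x))) 0 0
    = Lambda x`_0 * bethe_coef (behead x).
  by rewrite mulmxA bra_eigen -scalemxAl mxE.
have xcons : x = x`_0 :: behead x by case: (x) sx.
rewrite -relT /transfer mulmxDl mulmxDr mxE relC {1}xcons /bethe_coef bethe_cons.
rewrite -!addrA addrA -opprD; apply/eqP; rewrite eq_sym subr_eq addrC.
apply/eqP; rewrite addrC; congr (_ + _).
rewrite mulmxDr mxE !mulmx_sumr !summxE; congr (_ + _); apply: eq_big_nat => k.
  case/andP=> k1 kn; rewrite -scalemxAr mxE -xE //= rm_cons -?lt0n ?rm0 //.
  by rewrite eq_sym -lt0n.
case/andP=> k1 kn; rewrite mulmx_sumr summxE; apply: eq_big_nat => l /andP[kl ln].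
have [k0 l0] : (0%N != k)%N /\ (0%N != l)%N by lia.
by rewrite -scalemxAr mxE -xE //= !rm_cons.
Qed.

End FunctionalRelation.

(** * Hessenberg determinants and increasing tuples *)

(* Cramer's rule: the only cofactor that contributes is, up to sign, the
   determinant of a triangular matrix with diagonal -1. *)
Lemma det_hessenberg (F : comPzRingType) N (H : 'M[F]_N) (v : 'cV[F]_N)
    (i0 i1 : 'I_N) :
  i0 = 0%N :> nat -> i1.+1 = N ->
  (forall i j : 'I_N, j = i.+1 :> nat -> H i j = -1) ->
  (forall i j : 'I_N, (i.+1 < j)%N -> H i j = 0) ->
  (forall i, i != i1 -> (H *m v) i 0 = 0) ->
  v i0 0 * \det H = (H *m v) i1 0.
Proof.
case: N => [|n] in H v i0 i1 *; first by case: i0.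
move=> i00 [i1n] Hs H0 Hv.
have {i00}-> : i0 = ord0 by exact: val_inj.
have {i1n}i1E : i1 = ord_max by exact: val_inj.
rewrite {}i1E in Hv *.
(* U is the identity with its first column replaced by v, so H U has first column H v, with a single
   nonzero entry at the bottom. The sign of its cofactor cancels the product of the n diagonal
   entries -1 of the minor. *)
pose U : 'M[F]_n.+1 := \matrix_(i, j) if j == ord0 then v i 0 else (i == j)%:R.
have detU : \det U = v ord0 0.
  rewrite det_trig; last first.
    apply/is_trig_mxP => i j ij; rewrite mxE -val_eqE /= (gtn_eqF (leq_ltn_trans _ ij)) //.
    by rewrite -val_eqE /= (ltn_eqF ij).
  rewrite big_ord_recl mxE eqxx big1 ?mulr1 // => i _.
  by rewrite mxE -val_eqE /= eqxx.
have colU i : \sum_j H i j * U j ord0 = (H *m v) i 0.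
  by rewrite mxE; apply: eq_bigr => j _; rewrite mxE eqxx.
rewrite -detU mulrC -det_mulmx (expand_det_col _ ord0) (bigD1 ord_max) //= big1.
  rewrite addr0 mxE.
  rewrite colU /cofactor; set M := row' _ _.
  have ME i j : M i j = H (lift ord_max i) (lift ord0 j).
    rewrite !mxE (bigD1 (lift ord0 j)) //= mxE -val_eqE /= eqxx mulr1 big1 ?addr0 //.
    by move=> k kj; rewrite mxE -val_eqE /= -[k == _]negbK kj mulr0.
  rewrite det_trig; last first.
    apply/is_trig_mxP => i j ij; rewrite ME H0 //= /bump.
    by rewrite [(n <= i)%N]leqNgt ltn_ord add0n add1n ltnS.
  rewrite (eq_bigr (fun=> -1)) => [|i _]; last first.
    by rewrite ME Hs //= /bump [(n <= i)%N]leqNgt ltn_ord.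
  by rewrite prodr_const card_ord /= addn0 -expr2 sqrr_sign mulr1.
by move=> i iN; rewrite mxE colU Hv // mul0r.
Qed.

Lemma sum_bin_diag b k :
  (\sum_(t < k) 'C(b + t, t) = if k is k'.+1 then 'C(b + k, k') else 0)%N.
Proof.
case: k => [|k]; first by rewrite big_ord0.
elim: k => [|k IH]; first by rewrite big_ord1 !bin0.
by rewrite big_ord_recr IH /= [(b + k.+2)%N]addnS binS addnC.
Qed.

Lemma incr_tuples0 s : incr_tuples 0 s = [:: [::]].
Proof. by case: s. Qed.

(* Lexicographic order groups the tuples by the length k - t of their initial
   run a, a + 1, a + 2, etc, longest first. *)
Lemma nth_incr_tuples k a b t off : (t <= k)%N -> (off < 'C(b + t, t))%N ->
  nth [::] (incr_tuples k (iota a (b + k).+1)) (\sum_(t' < t) 'C(b + t', t') + off)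
  = iota a (k - t) ++ nth [::] (incr_tuples t (iota (a + (k - t)).+1 (b + t))) off.
Proof.
elim: k a t => [|k IH] a t tk offlt.
  by move: tk offlt; rewrite leqn0 => /eqP ->; rewrite bin0 big_ord0 !incr_tuples0; case: off.
rewrite [iota a _]/= [incr_tuples _ _]/= nth_cat size_map size_incr_tuples size_iota.
have [tk'|] := ltnP k t.
  have -> : t = k.+1 by apply/eqP; rewrite eqn_leq tk.
  rewrite sum_bin_diag ltnNge leq_addr /= addKn subnn /= addn0.
  by rewrite addnS.
move=> {}tk.
have lt_first : (\sum_(t' < t) 'C(b + t', t') + off < 'C((b + k).+1, k))%N.
  have := sum_bin_diag b k.+1; rewrite addnS => <-.
  apply: (@leq_trans (\sum_(t' < t.+1) 'C(b + t', t'))%N).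
    by rewrite big_ord_recr /= ltn_add2l.
  rewrite (big_ord_widen k.+1 (fun t' => 'C(b + t', t'))) //.
  by rewrite [leqRHS](bigID (fun i : 'I_ _ => (i < t.+1)%N)) leq_addr.
rewrite ifT ?addnS // (nth_map [::]) ?IH //; last first.
  by rewrite size_incr_tuples size_iota.
by rewrite subSn //= addSn addnS.
Qed.

Lemma leq_bin_prefix j t l : ('C(l, t) <= 'C(j + l, j + t))%N.
Proof.
elim: j => //= j IH; rewrite !addSn binS; apply: leq_trans IH _.
exact: leq_addl.
Qed.

(** Tuples starting with the full run of length j come first in lexicographic order, and there are
    'C(l, t) of them. *)
Lemma nth_incr_tuples_prefix j t a l off : (off < 'C(l, t))%N ->
  nth [::] (incr_tuples (j + t) (iota a (j + l))) off
  = iota a j ++ nth [::] (incr_tuples t (iota (a + j) l)) off.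
Proof.
elim: j a => [|j IH] a lt_off; first by rewrite addn0.
have bin_le := leq_trans lt_off (leq_bin_prefix j t l).
rewrite !addSn /= nth_cat size_map size_incr_tuples size_iota bin_le.
by rewrite (nth_map [::]) ?size_incr_tuples ?size_iota // IH // addSnnS.
Qed.

Lemma filter_iota_prefix a n l (s : seq nat) :
  [seq k <- iota a (n + l) | k \notin iota a n ++ s]
  = [seq k <- iota (a + n) l | k \notin s].
Proof.
rewrite iotaD filter_cat (_ : [seq k <- iota a n | _] = [::]); last first.
  apply/eqP; rewrite -[_ == _]negbK -has_filter; apply/hasPn => k kn.
  by rewrite mem_cat kn.
apply: eq_in_filter => k; rewrite mem_cat !mem_iota => /andP[ank _].
by rewrite ltnNge ank andbF.
Qed.

Lemma incr_tuples_uniq k s : sorted ltn s -> uniq (incr_tuples k s).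
Proof.
move=> /(sorted_incr_tuples k) srt.
by apply: (sorted_uniq _ _ srt); [exact: lt_trans | exact: ltxx].
Qed.

Lemma incr_tuples1 s : incr_tuples 1 s = [seq [:: x] | x <- s].
Proof. by elim: s => //= x s ->; rewrite incr_tuples0. Qed.

(** In this form the pairs with k = 0 match the entries M of [coef_list], and those with k > 0 the
    entries N. *)
Lemma incr_tuples2 a n :
  incr_tuples 2 (iota a n.+1)
  = [seq [:: (a + k)%N; (a + l)%N] | k <- iota 0 n.+1, l <- iota k.+1 (n - k)].
Proof.
elim: n a => [|n IH] a; first by [].
have -> : incr_tuples 2 (iota a n.+2)
  = map (cons a) (incr_tuples 1 (iota a.+1 n.+1)) ++ incr_tuples 2 (iota a.+1 n.+1) by [].
have -> : [seq [:: (a + k)%N; (a + l)%N] | k <- iota 0 n.+2, l <- iota k.+1 (n.+1 - k)]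
  = [seq [:: (a + 0)%N; (a + l)%N] | l <- iota 1 n.+1]
    ++ [seq [:: (a + k)%N; (a + l)%N] | k <- iota 1 n.+1, l <- iota k.+1 (n.+1 - k)].
  by [].
rewrite IH incr_tuples1 -map_comp; congr (_ ++ _).
  rewrite -[a.+1]addn1 iotaDl -map_comp; apply: eq_map => l /=.
  by rewrite addn0.
congr flatten; rewrite (iotaDl 1 0) -map_comp; apply: eq_map => k /=.
rewrite (iotaDl 1 k.+1) -map_comp; apply: eq_map => l /=.
by rewrite !addSnnS.
Qed.

(** * Block rows of the linear system *)

Lemma del_subseq i s : (0 < i)%N -> subseq (del i s) s.
Proof.
case: i => // i _; rewrite /del -[X in subseq _ X](cat_take_drop i s).
have -> : drop i.+1 s = drop 1 (drop i s) by rewrite drop_drop add1n.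
by apply: cat_subseq; rewrite ?drop_subseq //= subseq_refl.
Qed.

Lemma size_del i s : (0 < i <= size s)%N -> size (del i s) = (size s).-1.
Proof.
case: i => // i /= si; rewrite size_cat size_drop size_takel; last exact: ltnW.
by lia.
Qed.

Lemma del2_subseq i j s : (0 < i)%N -> (0 < j)%N -> subseq (del2 i j s) s.
Proof. by move=> i0 j0; apply: subseq_trans (del_subseq _ j0); apply: del_subseq. Qed.

Lemma size_del2 i j s : (0 < i)%N -> (i < j <= size s)%N ->
  size (del2 i j s) = (size s).-2.
Proof.
by move=> i0 /andP[ij js]; rewrite size_del size_del // -?lt0n; lia.
Qed.

Section Complement.
Variables (p n : nat).
Let compl (s : seq nat) := [seq k <- iota p n | k \notin s].

Lemma compl_subseq s : subseq (compl s) (iota p n).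
Proof. exact: filter_subseq. Qed.

Lemma size_compl s : subseq s (iota p n) -> size (compl s) = (n - size s)%N.
Proof.
move/(subseq_uniqP (iota_uniq p n)) => sE.
have -> : size s = count (mem s) (iota p n) by rewrite {1}sE size_filter.
have := count_predC (mem s) (iota p n).
by rewrite size_iota size_filter => E; rewrite -[X in (X - _)%N]E addKn.
Qed.

Lemma complK s : subseq s (iota p n) -> compl (compl s) = s.
Proof.
move/(subseq_uniqP (iota_uniq p n)) => {2}->; apply: eq_in_filter => k kn.
by rewrite mem_filter kn andbT negbK.
Qed.

End Complement.

Section Rows.
Variables (R : realType) (L : nat) (gamma : R[i]) (mu : L.-tuple R[i]).
Variables (Lambda : R[i] -> R[i]) (lam : L.-tuple R[i]).
Local Notation K := (R[i]).
Variable phi : seq nat -> K.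
Hypothesis L0 : (0 < L)%N.

Local Notation cM n k O := (Defs.coefM gamma mu n k (eval_vec lam O)).
Local Notation cN n l k O := (Defs.coefN gamma mu n l k (eval_vec lam O)).

Hypothesis rel_phi : forall O n, subseq O (iota 0 L) -> size O = n.+1 ->
  phi O = Lambda lam`_(head 0%N O) * phi (behead O)
    - (\sum_(1 <= k < n.+1) cM n k O * phi (del2 1 k.+1 O)
       + \sum_(1 <= k < n.+1) \sum_(k.+1 <= l < n.+1)
           cN n l k O * phi (del2 k.+1 l.+1 O)).

(* The rows and columns numbered m are labelled by the sets of variables
   X^{base m, L-1} minus [removed m] indices; for both parities of m such a set
   has L + 1 - m elements, so that A_-, A_0 and A_+ relate consecutive values
   of this number. *)
Definition base (m : nat) : nat := if odd m then 0 else 1.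
Definition removed (m : nat) : nat := if odd m then (m - 1)%N else (m - 2)%N.

Lemma base_lt m : (base m <= L)%N. Proof. by rewrite /base; case: odd. Qed.

Lemma block_tuplesE m :
  block_tuples L m = incr_tuples (removed m) (iota (base m) (L - base m)).
Proof. by rewrite /block_tuples /removed /base; case: odd; rewrite ?subn0. Qed.

Definition vars (m : nat) (ii : seq nat) : seq nat := Ovec (base m) (L - 1) ii.

Lemma varsE m ii :
  vars m ii = [seq k <- iota (base m) (L - base m) | k \notin ii].
Proof. by rewrite /vars /Ovec subn1 prednK. Qed.

Lemma vars_subseq m ii : subseq (vars m ii) (iota 0 L).
Proof.
rewrite varsE; apply: subseq_trans (compl_subseq _ _ _) _.
by rewrite -{2}(subnKC (base_lt m)) iotaD add0n suffix_subseq.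
Qed.

Definition tuple_of m s := nth [::] (block_tuples L m) s.

Lemma tuple_ofP m s : (1 < m <= L.+1)%N -> (s < bdim L m)%N ->
  [/\ size (tuple_of m s) = removed m,
      subseq (tuple_of m s) (iota (base m) (L - base m)) &
      size (vars m (tuple_of m s)) = (L.+1 - m)%N].
Proof.
move=> mL sm; have : tuple_of m s \in block_tuples L m.
  by rewrite mem_nth // size_block_tuples.
rewrite block_tuplesE mem_incr_tuples => /andP[/eqP st sub]; split=> //.
rewrite varsE size_compl // st /removed /base; move: mL; case: (odd m) (odd_gt0 (n := m)).
  by lia.
by lia.
Qed.

Definition colV m : 'cV[K]_(bdim L m) := \col_s phi (vars m (tuple_of m s)).

Lemma sum_tuples m (G : seq nat -> K) : (1 < m <= L.+1)%N ->
  \sum_(s < bdim L m) G (tuple_of m s) = \sum_(jj <- block_tuples L m) G jj.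
Proof.
by move=> mL; rewrite (big_nth [::]) big_mkord size_block_tuples.
Qed.

(** Complementation is an involution, so exactly one column has variable set T. Its tuple contains
    [ii] because T avoids [ii], hence all Kronecker factors are 1. *)
Lemma select_tuple m ii T :
  (1 < m)%N -> (m.+2 <= L.+1)%N -> subseq ii (iota (base m) (L - base m)) ->
  size ii = removed m -> subseq T (vars m ii) -> size T = (L.+1 - m).-2 ->
  \sum_(jj <- block_tuples L m.+2)
    (if vars m jj == T then \prod_(i <- ii) (i \in jj)%:R * phi (vars m jj) else 0)
  = phi T.
Proof.
move=> m1 mL iiS ii_size TS T_size; set p := base m.
have TS' : subseq T (iota p (L - p)).
  by apply: subseq_trans TS _; rewrite varsE compl_subseq.
have base2 : base m.+2 = p by rewrite /base /= negbK.
pose jj0 := vars m T.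
have jj0K : vars m jj0 = T by rewrite /jj0 !varsE complK.
have jj0_in : jj0 \in block_tuples L m.+2.
  rewrite block_tuplesE base2 mem_incr_tuples /jj0 varsE compl_subseq andbT.
  rewrite size_compl // T_size /removed /base /= negbK /p /base; apply/eqP.
  by move: m1 mL; case: (odd m) (odd_gt0 (n := m)); lia.
rewrite (bigD1_seq jj0) //=; last first.
  by rewrite block_tuplesE incr_tuples_uniq // iota_ltn_sorted.
rewrite jj0K eqxx [X in _ + X]big_seq_cond [X in _ + X]big1 ?addr0.
  rewrite big_seq big1 ?mul1r // => i i_ii.
  rewrite /jj0 varsE mem_filter (mem_subseq iiS) // andbT.
  rewrite (_ : i \notin T) //; apply/negP => /(mem_subseq TS).
  by rewrite varsE mem_filter i_ii.
move=> jj /andP[jj_in jjN]; case: eqP => // jjT; case/eqP: jjN.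
move: jj_in; rewrite block_tuplesE base2 mem_incr_tuples => /andP[_ jjS].
by rewrite /jj0 -jjT !varsE complK.
Qed.

Lemma Aminus_row m (r : 'I_(bdim L m)) : (1 < m)%N -> (m.+2 <= L.+1)%N ->
  let O := vars m (tuple_of m r) in let n := (L - m)%N in
  (Aminus_gt2 gamma mu lam m *m colV m.+2) r 0
  = - (\sum_(1 <= k < n.+1) cM n k O * phi (del2 1 k.+1 O)
       + \sum_(1 <= k < n.+1) \sum_(k.+1 <= l < n.+1)
           cN n l k O * phi (del2 k.+1 l.+1 O)).
Proof.
move=> m1 mL O n.
have mL1 : (1 < m <= L.+1)%N by lia.
have mL2 : (1 < m.+2 <= L.+1)%N by lia.
have [ii_size iiS O_size] := tuple_ofP mL1 (ltn_ord r).
set ii := tuple_of m r in ii_size iiS O_size O *.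
have vars2 jj : vars m.+2 jj = vars m jj by rewrite /vars /base /= negbK.
rewrite mxE.
pose G jj := Aminus_entry gamma mu lam (base m) m ii jj * phi (vars m.+2 jj).
transitivity (\sum_(s < bdim L m.+2) G (tuple_of m.+2 s)).
  by apply: eq_bigr => s _; rewrite !mxE.
rewrite sum_tuples // /G.
pose D jj := \prod_(i <- ii) (i \in jj)%:R * phi (vars m jj).
have sel T : subseq T O -> size T = (size O).-2 ->
    \sum_(jj <- block_tuples L m.+2) (if vars m jj == T then D jj else 0) = phi T.
  by move=> TO TS; apply: select_tuple => //; rewrite TS O_size.
have n1 : size O = n.+1 by rewrite O_size /n; lia.
transitivity (\sum_(jj <- block_tuples L m.+2)
  - (\sum_(1 <= k < n.+1) cM n k O * (if vars m jj == del2 1 k.+1 O then D jj else 0)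
     + \sum_(1 <= k < n.+1) \sum_(k.+1 <= l < n.+1)
         cN n l k O * (if vars m jj == del2 k.+1 l.+1 O then D jj else 0))).
  apply: eq_bigr => jj _; rewrite vars2 /Aminus_entry -/(vars m ii) -/(vars m jj).
  rewrite -/n -/O mulNr mulrAC -/(D jj) mulrDr; congr (- (_ + _)).
    rewrite [in LHS]big_mkcond mulr_sumr; apply: eq_bigr => k _.
    by rewrite eq_sym; case: eqP => _; rewrite ?mulr0 // mulrC.
  rewrite mulr_sumr; apply: eq_bigr => k _.
  rewrite [in LHS]big_mkcond mulr_sumr; apply: eq_bigr => l _.
  by rewrite eq_sym; case: eqP => _; rewrite ?mulr0 // mulrC.
rewrite sumrN; congr (- _); rewrite big_split /=; congr (_ + _).
  rewrite exchange_big; apply: eq_big_nat => k /andP[k1 kn].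
  by rewrite -mulr_sumr sel ?del2_subseq ?size_del2 // n1; lia.
rewrite exchange_big; apply: eq_big_nat => k /andP[k1 kn].
rewrite exchange_big; apply: eq_big_nat => l /andP[kl ln].
by rewrite -mulr_sumr sel ?del2_subseq ?size_del2 // n1; lia.
Qed.

Lemma conform_row_mx (n n' k : nat) (A : 'M[K]_(n', k)) (e : n' = n) (r : 'I_n) s :
  (conform_mx (0 : 'M_(n, k)) A) r s = A (cast_ord (esym e) r) s.
Proof. by case: n / e r => r; rewrite conform_mx_id cast_ord_id. Qed.

(** The block of W containing row r is determined by the initial run of the removed tuple, and the
    first index after that run is the head of O. Removing the head as well lengthens the run, so the
    new tuple sits near the start of the next list, at the offset of r inside its block: this is why
    each W is an identity padded on the right. *)
Lemma Azero_row m (r : 'I_(bdim L m)) : (1 < m)%N -> (m <= L)%N ->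
  let O := vars m (tuple_of m r) in
  (Azero_gt2 Lambda lam m *m colV m.+1) r 0
  = Lambda lam`_(head 0%N O) * phi (behead O).
Proof.
move=> m1 mL O.
have m1L : (1 < m <= L)%N by rewrite m1.
rewrite mxE; under eq_bigr => s _ do
  rewrite (conform_row_mx _ (sum_wdim m1L)) !mxE.
set r' := cast_ord _ r; set t := tagnat.sig1 r'; set off := tagnat.sig2 r'.
have tT : (t < if odd m then m else m.-1)%N := ltn_ord t.
have trem : (t <= removed m)%N.
  by move: tT; move: (nat_of_ord t) => t1; rewrite /removed; case: (odd m); lia.
pose b := (L - m)%N.
have wdimb (t' : nat) : (t' <= removed m)%N -> wdim L m (m - t') = 'C(b + t', t').
  move=> t'm; have t'm' : (t' <= m)%N.
    by apply: leq_trans t'm _; rewrite /removed; case: (odd m); lia.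
  by rewrite wdimE; [congr 'C(_, _)|]; rewrite /b; lia.
have off_lt : (off < 'C(b + t, t))%N by rewrite -wdimb // ltn_ord.
have rE : r = (\sum_(t' < t) 'C(b + t', t') + off)%N :> nat.
  rewrite -[LHS]/(nat_of_ord r') tagnat.rect -/t -/off; congr (_ + _)%N.
  rewrite (big_ord_widen (if odd m then m else m.-1) (fun t' => 'C(b + t', t')));
    last exact: ltnW.
  by apply: eq_bigr => t' t't; rewrite wdimb // ltnW // (leq_trans t't).
have [q qE] : exists q, q = (removed m - t)%N by exists (removed m - t)%N.
pose a1 := (base m + q)%N.
pose rest := nth [::] (incr_tuples t (iota a1.+1 (b + t))) off.
have sizeL : (L - base m = (b + removed m).+1)%N.
  by rewrite /base /removed /b; case: (odd m) (odd_gt0 (n := m)); lia.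
have row_tuple : tuple_of m r = iota (base m) q ++ rest.
  by rewrite /tuple_of block_tuplesE sizeL rE nth_incr_tuples // /rest /a1 qE.
have [j jt] : exists j, (j + t)%N = removed m.+1.
  exists (removed m.+1 - t)%N; rewrite subnK // (leq_trans trem) // /removed /=.
  by case: (odd m) => /=; lia.
have basej : (base m.+1 + j)%N = a1.+1.
  move: jt qE trem; move: (nat_of_ord t) => t1; rewrite /a1 /base /removed /=.
  by case: (odd m) (odd_gt0 (n := m)) => //=; lia.
have sizeL1 : (L - base m.+1 = j + (b + t))%N.
  move: jt qE trem; move: (nat_of_ord t) => t1; rewrite /a1 /base /removed /b /=.
  by case: (odd m) (odd_gt0 (n := m)) => //=; lia.
have col_tuple : tuple_of m.+1 off = iota (base m.+1) j ++ rest.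
  by rewrite /tuple_of block_tuplesE sizeL1 -jt nth_incr_tuples_prefix // basej.
have off_lt1 : (off < bdim L m.+1)%N.
  rewrite -size_block_tuples; last by rewrite ltnS; lia.
  rewrite block_tuplesE size_incr_tuples size_iota sizeL1 -jt.
  exact: leq_trans off_lt (leq_bin_prefix _ _ _).
have OE : O = a1 :: vars m.+1 (tuple_of m.+1 off).
  rewrite col_tuple varsE sizeL1 filter_iota_prefix basej /O row_tuple varsE.
  rewrite (_ : L - base m = q + (b + t).+1)%N; last by rewrite sizeL qE; lia.
  rewrite filter_iota_prefix -/a1 /= ifT //; apply/negP => a1_rest.
  have : rest \in incr_tuples t (iota a1.+1 (b + t)).
    by rewrite mem_nth // size_incr_tuples size_iota.
  rewrite mem_incr_tuples => /andP[_ /mem_subseq/(_ _ a1_rest)].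
  by rewrite mem_iota ltnn.
have a1E : (m - t).-1 = a1.
  move: qE trem; move: (nat_of_ord t) => t1; rewrite /a1 /base /removed.
  by case: (odd m) (odd_gt0 (n := m)) => //=; lia.
rewrite OE /= -a1E (bigD1 (Ordinal off_lt1)) //= eqxx (ltn_ord off) mulr1.
rewrite big1 ?addr0 // => s sN.
rewrite (_ : (off == s :> nat) = false) ?mulr0 ?mul0r //.
by apply: contraNF sN => /eqP offs; apply/eqP/val_inj.
Qed.

Lemma vars_pair m k l n : (k < l)%N -> (l <= n)%N -> (L - base m = n.+1)%N ->
  vars m [:: (base m + k)%N; (base m + l)%N] = del2 k.+1 l.+1 (iota (base m) n.+1).
Proof.
move=> kl ln sizeL; rewrite varsE sizeL -[X in iota X _]addn0 iotaDl.
rewrite -map_del2 del2_iota // filter_map /rm -filter_predI; congr map.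
by apply: eq_filter => i /=; rewrite !inE !eqn_add2l negb_or.
Qed.

Lemma sum_coef_list n x m (N : nat) :
  (1 < m)%N -> removed m = 2 -> (L - base m = n.+1)%N -> N = 'C(n.+1, 2) ->
  \sum_(s < N) (coef_list gamma mu n x)`_s * phi (vars m (tuple_of m s))
  = \sum_(1 <= k < n.+1) Defs.coefM gamma mu n k x
        * phi (del2 1 k.+1 (iota (base m) n.+1))
    + \sum_(1 <= k < n.+1) \sum_(k.+1 <= l < n.+1) Defs.coefN gamma mu n l k x
        * phi (del2 k.+1 l.+1 (iota (base m) n.+1)).
Proof.
move=> m1 rem2 sizeL NE; pose a := base m.
pose ps := [seq (k, l) | k <- iota 1 n, l <- iota k.+1 (n - k)].
(* A common index list for coefficients and columns: [inl k] stands for M_k, which removes the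
   components 0 and k, and [inr (k, l)] for N_{l,k}. *)
pose S : seq (nat + nat * nat) := map inl (iota 1 n) ++ map inr ps.
pose f (z : nat + nat * nat) := match z with
  | inl k => Defs.coefM gamma mu n k x | inr p => Defs.coefN gamma mu n p.2 p.1 x end.
pose h (z : nat + nat * nat) := match z with
  | inl k => [:: (a + 0)%N; (a + k)%N] | inr p => [:: (a + p.1)%N; (a + p.2)%N] end.
have coefE : coef_list gamma mu n x = map f S.
  rewrite /coef_list /S map_cat -!map_comp; congr (_ ++ _).
  by rewrite /ps map_allpairs.
have tuplesE : block_tuples L m = map h S.
  rewrite block_tuplesE rem2 sizeL incr_tuples2 /S map_cat -!map_comp.
  rewrite [X in _ = _ ++ X](_ : _ = [seq [:: (a + k)%N; (a + l)%N] |
      k <- iota 1 n, l <- iota k.+1 (n - k)]).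
    by rewrite [iota 0 n.+1]/= /= subn0.
  by rewrite /ps map_allpairs.
have sizeS : size S = N.
  by rewrite NE -(size_coef_list gamma mu n x) coefE size_map.
transitivity (\sum_(z <- S) f z * phi (vars m (h z))).
  rewrite (big_nth (inl 0%N)) sizeS big_mkord; apply: eq_bigr => s _.
  by rewrite /tuple_of coefE tuplesE !(nth_map (inl 0%N)) ?sizeS.
have index_iotaE k : iota k.+1 (n - k) = index_iota k.+1 n.+1.
  by rewrite /index_iota subSS.
rewrite big_cat !big_map; congr (_ + _).
  rewrite (_ : iota 1 n = index_iota 1 n.+1); last by rewrite -(index_iotaE 0%N) subn0.
  by apply: eq_big_nat => k /andP[k1 kn]; rewrite /= (vars_pair k1 _ sizeL).
rewrite /ps big_allpairs_dep (_ : iota 1 n = index_iota 1 n.+1); last first.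
  by rewrite -(index_iotaE 0%N) subn0.
apply: eq_big_nat => k _; rewrite index_iotaE; apply: eq_big_nat => l /andP[kl ln].
by rewrite /= (vars_pair kl _ sizeL).
Qed.

(** Combines the relations for all L variables and for the last L - 1, eliminating the value of phi
    at the latter. Its leading term leaves Lambda(lambda_0) Lambda(lambda_1) phi(lambda_2, ...,
    lambda_(L-1)), located in the first column of width [3]. *)
Lemma last_row (r : 'I_(bdim L 2)) : (2 < L)%N ->
  (Aminus2 gamma mu Lambda lam *m colV 4) r 0
  + (Azero2 gamma mu Lambda lam *m colV 3) r 0 = phi (iota 0 L).
Proof.
move=> L2; have L1 : (L - 1 = (L - 2).+1)%N by lia.
have LE : L = (L - 1).+1 by lia.
have lamE : eval_vec lam (iota 0 L) = lam.
  by rewrite /eval_vec -[X in iota 0 X](size_tuple lam); apply: mkseq_nth.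
have relL := @rel_phi (iota 0 L) (L - 1) (subseq_refl _) (etrans (size_iota 0 L) LE).
have sub1 : subseq (iota 1 (L - 1)) (iota 0 L).
  by rewrite [X in iota 0 X]LE; apply: subseq_cons.
have rel1 := @rel_phi (iota 1 (L - 1)) (L - 2) sub1 (etrans (size_iota 1 (L - 1)) L1).
have headL : head 0%N (iota 0 L) = 0%N by rewrite LE.
have beheadL : behead (iota 0 L) = iota 1 (L - 1) by rewrite [X in iota 0 X]LE.
have head1 : head 0%N (iota 1 (L - 1)) = 1%N by rewrite L1.
have behead1 : behead (iota 1 (L - 1)) = iota 2 (L - 2) by rewrite L1.
rewrite relL headL beheadL rel1 head1 behead1 lamE.
have dim4 : bdim L 4 = 'C((L - 2).+1, 2).
  by rewrite bdimE ?L1 //=; lia.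
have dim3 : bdim L 3 = 'C((L - 1).+1, 2).
  by rewrite bdimE /= -?LE //; lia.
have := @sum_coef_list (L - 2) (eval_vec lam (iota 1 (L - 1))) 4 _ isT erefl L1 dim4.
have := @sum_coef_list (L - 1) lam 3 _ isT erefl (etrans (subn0 L) LE) dim3.
rewrite -LE -L1 [base 4]/= [base 3]/= => sum3 sum4.
rewrite -sum3 -sum4 !mxE {sum3 sum4 relL rel1}.
rewrite (eq_bigr (fun s : 'I_(bdim L 4) => - (Lambda lam`_0
    * ((coef_list gamma mu (L - 2) (eval_vec lam (iota 1 (L - 1))))`_s
       * phi (vars 4 (tuple_of 4 s)))))); last first.
  by move=> s _; rewrite !mxE; ring.
rewrite sumrN -mulr_sumr.
rewrite [X in _ + X](eq_bigr (fun s : 'I_(bdim L 3) =>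
    Lambda lam`_0 * Lambda lam`_1 * phi (vars 3 (tuple_of 3 s)) *+ (s == 0%N :> nat)
    - (coef_list gamma mu (L - 1) lam)`_s * phi (vars 3 (tuple_of 3 s)))); last first.
  by move=> s _; rewrite !mxE; case: eqP => _; rewrite ?mulr1n ?mulr0n; ring.
have dim3_gt0 : (0 < bdim L 3)%N by rewrite dim3 bin_gt0; lia.
rewrite sumrB (bigD1 (Ordinal dim3_gt0)) //= mulr1n.
rewrite [\sum_(i < _ | i != Ordinal dim3_gt0) _]big1; last first.
  move=> s; case: (nat_of_ord s =P 0%N) => // s0 /eqP sN.
  by case: sN; apply: val_inj.
have -> : vars 3 (tuple_of 3 0) = iota 2 (L - 2).
  rewrite varsE /tuple_of block_tuplesE [removed 3]/= [base 3]/= !subn0.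
  have [l ->] : exists l, L = l.+2 by exists (L - 2)%N; lia.
  rewrite incr_tuples2 subSS subSS subn0 [nth _ _ _]/=.
  rewrite (filter_iota_prefix 0 2 l [::]) -[RHS]filter_predT.
  exact: eq_filter.
by ring.
Qed.

End Rows.

(** * Determinant of the linear system *)

Lemma castmx_mulmx (F : pzSemiRingType) (m n n' p : nat) (e : n' = n)
    (X : 'M[F]_(m, n')) (Y : 'M[F]_(n', p)) :
  castmx (erefl, e) X *m castmx (e, erefl) Y = X *m Y.
Proof. by case: n / e; rewrite !castmx_id. Qed.

Section Assembly.
Variables (R : realType) (L : nat) (gamma : R[i]) (mu : L.-tuple R[i]).
Variables (Lambda : R[i] -> R[i]) (lam : L.-tuple R[i]).
Local Notation K := (R[i]).
Variable phi : seq nat -> K.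
Hypothesis L2 : (2 < L)%N.
Let L0 : (0 < L)%N. Proof. by lia. Qed.

Hypothesis rel_phi : forall O n, subseq O (iota 0 L) -> size O = n.+1 ->
  phi O = Lambda lam`_(head 0%N O) * phi (behead O)
    - (\sum_(1 <= k < n.+1) Defs.coefM gamma mu n k (eval_vec lam O) * phi (del2 1 k.+1 O)
       + \sum_(1 <= k < n.+1) \sum_(k.+1 <= l < n.+1)
           Defs.coefN gamma mu n l k (eval_vec lam O) * phi (del2 k.+1 l.+1 O)).

Local Notation V := (colV L phi).
Local Notation H := (Hblock gamma mu Lambda lam).

(** The labels w of the block columns range from 3 to L + 1, so the first block row lacks A_- and
    the last one lacks A_+. *)
Lemma block_row_sum m (r : 'I_(bdim L m)) : (1 < m)%N -> (m <= L)%N ->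
  \sum_(3 <= w < L.+2) (H m w *m V w) r 0
  = (if (m < L)%N then (Aminus gamma mu Lambda lam m *m V m.+2) r 0 else 0)
    + (Azero gamma mu Lambda lam m *m V m.+1) r 0
    - (if (2 < m)%N then V m r 0 else 0).
Proof.
move=> m1 mL.
rewrite (eq_bigr (fun w =>
    (if w == m.+2 then (Aminus gamma mu Lambda lam m *m V m.+2) r 0 else 0)
    + (if w == m.+1 then (Azero gamma mu Lambda lam m *m V m.+1) r 0 else 0)
    - (if w == m then V m r 0 else 0))); last first.
  move=> w _; rewrite /Hblock.
  have [->|_] := eqVneq w m.+2.
    by rewrite conform_mx_id !gtn_eqF ?addr0 ?subr0 // -?addn2 ?leq_addr; lia.
  have [->|_] := eqVneq w m.+1.
    by rewrite conform_mx_id gtn_eqF // add0r subr0.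
  have [->|_] := eqVneq w m; last by rewrite mul0mx mxE !addr0 subr0.
  by rewrite conform_mx_id /Aplus mulNmx mul1mx mxE !add0r.
rewrite sumrB big_split /= -!big_mkcond !big_nat1_eq; congr (_ + _ - _).
- by rewrite !ltnS; case: ltnP => //; lia.
- by rewrite ifT //; lia.
- by rewrite (_ : _ && _ = (2 < m)%N) //; lia.
Qed.

Lemma block_row m (r : 'I_(bdim L m)) : (1 < m)%N -> (m <= L)%N ->
  \sum_(j < L.-1) (H m (L.+1 - j) *m V (L.+1 - j)) r 0
  = if m == 2 then phi (iota 0 L) else 0.
Proof.
move=> m1 mL.
transitivity (\sum_(3 <= w < L.+2) (H m w *m V w) r 0).
  rewrite -(big_mkord xpredT (fun j => (H m (L.+1 - j) *m V (L.+1 - j)) r 0)).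
  rewrite [RHS](big_addn 0 _ 3) [RHS]big_nat_rev /=.
  rewrite (_ : L.+2 - 3 = L.-1)%N; last by lia.
  apply: eq_big_nat => j /andP[_ jL].
  by rewrite (_ : 0 + L.-1 - j.+1 + 3 = L.+1 - j)%N //; lia.
rewrite block_row_sum //; have [m2|mN2] := eqVneq m 2.
  subst m; rewrite L2 subr0 /Aminus /Azero /= !conform_mx_id.
  exact: (last_row L0 rel_phi).
have m3 : (2 < m)%N by lia.
rewrite m3 /Aminus /Azero (negPf mN2) (Azero_row _ _ _ L0) //.
have [O_size Osub] : size (vars L m (tuple_of L m r)) = (L - m).+1
    /\ subseq (vars L m (tuple_of L m r)) (iota 0 L).
  split; last exact: vars_subseq.
  have [|_ _ ->] := @tuple_ofP L L0 m r _ (ltn_ord r); lia.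
rewrite [V m r 0]mxE (rel_phi Osub O_size).
case: ltnP => [mL'|Lm].
  by rewrite Aminus_row // [- _ + _]addrC subrr.
(* In the first block row O is a single variable, and C contributes nothing. *)
have -> : (L - m = 0)%N by lia.
by rewrite !big_geq // !addr0 subr0 add0r subrr.
Qed.

Let P k := (\sum_(t < k) bdim L (L - t))%N.

Let P_S k : P k.+1 = (P k + bdim L (L - k))%N.
Proof. exact: big_ord_recr. Qed.

Let P_le k l : (k <= l)%N -> (P k <= P l)%N.
Proof.
move/subnK <-; elim: (l - k)%N => // d IH.
by rewrite addSn P_S (leq_trans IH) ?leq_addr.
Qed.

Lemma Hblock_diag m w (r : 'I_(bdim L m)) (s : 'I_(bdim L w)) : w = m ->
  H m w r s = - (r == s :> nat)%:R.
Proof.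
move=> wm; subst w; rewrite /Hblock eqxx conform_mx_id.
have [-> ->] : (m == m.+2) = false /\ (m == m.+1) = false by split; rewrite ltn_eqF.
by rewrite !mxE.
Qed.

Lemma Hblock_upper m w : (w < m)%N -> H m w = 0.
Proof. by move=> wm; rewrite /Hblock !ltn_eqF ?leqW. Qed.

Lemma sum_ord_lt (p : nat -> nat) n (k : 'I_n) :
  (\sum_(i < n | (i < k)%N) p i = \sum_(i < k) p i)%N.
Proof. by rewrite [RHS](big_ord_widen n) // ltnW. Qed.

(** The leading block column has width [L+1] = 1 and the following ones repeat the heights of the
    block rows. Columns are therefore shifted by one against rows, and the diagonals of the blocks
    A_+ fall on the superdiagonal of the whole matrix. *)
Lemma HL_above_diag (i j : 'I_(\sum_(i < L.-1) bdim L (L - i))) : (i < j)%N ->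
  HL gamma mu Lambda lam i j = - (j == i.+1 :> nat)%:R.
Proof.
move=> ij; rewrite /HL castmxE cast_ord_id mxE.
set c := cast_ord _ j.
have iE : i = (P (tagnat.sig1 i) + tagnat.sig2 i)%N :> nat.
  by rewrite {1}tagnat.rect (sum_ord_lt (fun t => bdim L (L - t))).
have jE : j = (\sum_(t < tagnat.sig1 c) bdim L (L.+1 - t) + tagnat.sig2 c)%N :> nat.
  by rewrite -[LHS]/(nat_of_ord c) {1}tagnat.rect (sum_ord_lt (fun t => bdim L (L.+1 - t))).
have [oi oj] := (ltn_ord (tagnat.sig2 i), ltn_ord (tagnat.sig2 c)).
move: (tagnat.sig2 i) (tagnat.sig2 c) oi oj iE jE.
move: (tagnat.sig1 i) (tagnat.sig1 c) => [I IL] [J JL] /= o o' oi oj iE jE.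
case: J JL o' oj jE => [|J] JL o' oj jE.
  have d1 : bdim L (L.+1 - 0) = 1%N by rewrite subn0 bdimL1.
  have : (o' < 1)%N by rewrite -[X in (_ < X)%N]d1.
  by rewrite ltnS leqn0 => /eqP o0; move: ij; rewrite jE big_ord0 o0.
have {}jE : j = (P J + o').+1 :> nat.
  rewrite jE big_ord_recl subn0 bdimL1 // add1n; congr (_ + _).+1.
have oj' : (o' < bdim L (L - J))%N := oj.
have iP : (i < P J.+1)%N.
  rewrite P_S; apply: (@leq_ltn_trans (P J + o')); first by rewrite -ltnS -jE.
  by rewrite ltn_add2l.
have IJ : (I <= J)%N.
  rewrite leqNgt; apply/negP => /P_le/(leq_trans iP).
  by rewrite iE ltnNge leq_addr.
have [IJ'|JI] := ltnP I J.
  rewrite Hblock_upper ?mxE; last by rewrite subSS; lia.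
  rewrite gtn_eqF ?oppr0 // jE ltnS; apply: leq_trans (leq_addr _ _).
  by apply: leq_trans (P_le IJ'); rewrite P_S iE ltn_add2l.
have IJE : I = J by lia.
rewrite Hblock_diag; last by lia.
have PE : P I = P J by rewrite IJE.
by rewrite jE iE PE eqSS eqn_add2l eq_sym.
Qed.

Lemma det_HL : phi [::] * \det (HL gamma mu Lambda lam) = phi (iota 0 L).
Proof.
have lastL : (L.-2 < L.-1)%N by lia.
pose last := Ordinal lastL.
have dlast : (0 < bdim L (L - last))%N.
  by rewrite (_ : (L - last = 2)%N) ?bdim2 //=; lia.
pose i1 : 'I_(\sum_(i < L.-1) bdim L (L - i)) := tagnat.Rank last (Ordinal dlast).
have N0 : (0 < \sum_(i < L.-1) bdim L (L - i))%N by exact: leq_ltn_trans (ltn_ord i1).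
pose i0 := Ordinal N0.
pose v := castmx (sum_bdim L, erefl 1%N) (\mxcol_(j < L.-1) V (L.+1 - j)).
have HvE i : (HL gamma mu Lambda lam *m v) i 0
    = if (L - tagnat.sig1 i == 2)%N then phi (iota 0 L) else 0.
  rewrite /HL /v castmx_mulmx mul_mxblock_mxrow mxE summxE block_row //; last exact: leq_subr.
  by have := ltn_ord (tagnat.sig1 i); move: (nat_of_ord (tagnat.sig1 i)) => s; lia.
have sig_i1 : tagnat.sig1 i1 = last by rewrite tagnat.Rank1K.
have i1N : i1.+1 = (\sum_(i < L.-1) bdim L (L - i))%N.
  rewrite /i1 tagnat.RankEsum (sum_ord_lt (fun t => bdim L (L - t))) [nat_of_ord last]/= addn0.
  rewrite -/(P L.-2) -/(P L.-1) (_ : L.-1 = L.-2.+1) ?P_S; last by lia.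
  by rewrite (_ : (L - L.-2 = 2)%N) ?bdim2 ?addn1 //; lia.
have := det_hessenberg (H := HL gamma mu Lambda lam) (v := v) (i0 := i0) (i1 := i1).
have -> : v i0 0 = phi [::].
  rewrite /v castmxE mxE; set c := cast_ord _ i0.
  have := tagnat.rect c; rewrite (sum_ord_lt (fun t => bdim L (L.+1 - t))) => cE.
  have J0 : tagnat.sig1 c = 0%N :> nat.
    move/esym/eqP: cE; rewrite addn_eq0 => /andP[+ _].
    by case: (nat_of_ord (tagnat.sig1 c)) => // J; rewrite big_ord_recl subn0 bdimL1.
  rewrite mxE; congr phi; apply: size0nil.
  have [|_ _ ->] := @tuple_ofP L L0 _ _ _ (ltn_ord (tagnat.sig2 c)).
    by rewrite J0 subn0 leqnn andbT; lia.
  by rewrite J0 subn0 subnn.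
rewrite HvE sig_i1 /= ifT; last by apply/eqP; lia.
apply => //.
- by move=> i j ji; rewrite HL_above_diag ji // eqxx.
- by move=> i j ij; rewrite HL_above_diag ?gtn_eqF ?oppr0 // ltnW.
move=> i iN; rewrite HvE ifF //; apply: contraNF iN => /eqP sig_i.
have sig1E : tagnat.sig1 i = last.
  by apply: val_inj => /=; move: sig_i (ltn_ord (tagnat.sig1 i)) => /=; lia.
apply/eqP/val_inj; rewrite -(tagnat.sig2K i); apply/eqP.
rewrite tagnat.eq_Rank; apply/andP; split; first by rewrite sig1E.
have d1 : bdim L (L - tagnat.sig1 i) = 1%N by rewrite sig_i bdim2.
by have := ltn_ord (tagnat.sig2 i); rewrite [X in (_ < X)%N]d1 ltnS leqn0.
Qed.

End Assembly.

(** * Application to the dual eigenvector *)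

Lemma bethe_prod (F : fieldType) (Q : nat) (I : eqType) (B : I -> 'M[F]_Q)
    (v : 'cV[F]_Q) s : bethe B v s = (\prod_(u <- s) B u) *m v.
Proof.
elim: s => [|u s IH]; first by rewrite big_nil mul1mx.
by rewrite bethe_cons IH big_cons mulmxA.
Qed.

Lemma generic_pairwise (R : realType) (L : nat) (gamma : R[i])
    (lam : L.-tuple R[i]) (O : seq nat) :
  generic gamma lam -> subseq O (iota 0 L) ->
  pairwise (generic_pair gamma) (eval_vec lam O).
Proof.
move=> gen /(map_subseq (nth 0 lam)) sub; apply: subseq_pairwise sub _.
apply/(pairwiseP 0) => i j; rewrite !inE size_map size_iota => iL jL ij.
rewrite !(nth_map 0%N) ?size_iota // !nth_iota // !add0n.
have ne : Ordinal iL != Ordinal jL by rewrite -val_eqE /= ltn_eqF.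
have [a1 b1] := gen _ _ ne; rewrite eq_sym in ne; have [a2 _] := gen _ _ ne.
by rewrite /generic_pair; rewrite !(tnth_nth 0) in a1 b1 a2; rewrite a1 a2 b1.
Qed.

Theorem lemma3p4 (R : realType) (L : nat) (gamma : R[i]) (mu : L.-tuple R[i])
    (Lambda : R[i] -> R[i])
    (Psi : 'cV[R[i]]_#|{: config L}|) (bra : 'rV[R[i]]_#|{: config L}|)
    (lam : L.-tuple R[i]) :
  (2 < L)%N ->
  is_eigenvector gamma mu Lambda Psi ->
  is_dual_eigenvector gamma mu Lambda bra ->
  F0_bar bra != 0 ->
  generic gamma lam ->
  partition_function gamma mu lam
    = kappa0 bra * \det (HL gamma mu Lambda lam).
Proof.
move=> L2 _ [_ bra_eigen] F0N gen.
pose phi s := bethe_coef gamma mu bra (eval_vec lam s).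
have rel_phi O n : subseq O (iota 0 L) -> size O = n.+1 ->
  phi O = Lambda lam`_(head 0%N O) * phi (behead O)
    - (\sum_(1 <= k < n.+1)
         Defs.coefM gamma mu n k (eval_vec lam O) * phi (del2 1 k.+1 O)
       + \sum_(1 <= k < n.+1) \sum_(k.+1 <= l < n.+1)
         Defs.coefN gamma mu n l k (eval_vec lam O) * phi (del2 k.+1 l.+1 O)).
  move=> sub sO; rewrite /phi /eval_vec.
  rewrite {1}(functional_relation bra_eigen sO (generic_pairwise gen sub)).
  rewrite -addrA -opprD; congr (_ - _).
  by case: (O) sO.
have lamE : eval_vec lam (iota 0 L) = lam.
  by rewrite /eval_vec -[X in iota 0 X](size_tuple lam); apply: mkseq_nth.
have phi0 : phi [::] = F0 bra by [].
have phiL : phi (iota 0 L) = partition_function gamma mu lam * F0_bar bra.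
  rewrite /phi /bethe_coef lamE bethe_prod partition_functionP -scalemxAr.
  by rewrite mxE.
by rewrite /kappa0 mulrAC -phi0 (det_HL L2 rel_phi) phiL mulfK.
Qed.
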